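(* Let $\{u_\delta\}_{\delta\in(0,\frac{2}{3\sqrt3})}$ be a family of non-constant functions such that, for each $\delta$, $u_\delta$ is a solution to $-\Delta u=u-u^3-\delta$ in $\mathbb{R}^N$, with $N\ge 2$. Assume furthermore that $u_\delta$ is periodic in $x_N$ and that, for any $\delta\in\left(0,\frac{2}{3\sqrt3}\right)$, there exists $R(\delta)>0$ such that $u_\delta>z_2(\delta)$ outside the cylinder $C_{R(\delta)}$. Then: (1) $z_1(\delta)<u_\delta(x)<z_3(\delta)$ for any $x\in\mathbb{R}^N$. (2) $u_\delta$ is radially symmetric in $x'$. (3) $u_\delta\to-1$ as $\delta\to0$ uniformly on compact subsets of $\mathbb{R}^N$.
   Context: For $\delta\in\left(-\frac{2}{3\sqrt3},\frac{2}{3\sqrt3}\right)$ the polynomial $f_\delta(t)=t-t^3-\delta$ has exactly three real roots, denoted $z_1(\delta)<-\frac1{\sqrt3}<z_2(\delta)<\frac1{\sqrt3}<z_3(\delta)$. Solutions are entire, i.e. defined on all of $\mathbb{R}^N$ (distributional solutions in $L^3_{loc}(\mathbb{R}^N)$ are in fact smooth). Points are written $x=(x',x_N)\in\mathbb{R}^{N-1}\times\mathbb{R}$, and $C_R:=\{(x',x_N)\in\mathbb{R}^N:|x'|<R\}$. Periodic in $x_N$ means that there is $T>0$ (possibly depending on $\delta$) with $u_\delta(x',x_N+T)=u_\delta(x',x_N)$ for all $x$. Radially symmetric in $x'$ means that, up to a translation, $u_\delta(x)=w_\delta(|x'|,x_N)$ for some function $w_\delta$.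
   Formalization: In (3) the convergence to -1 is asserted for suitable translates u_δ(·+a_δ), with the same a_δ in R^N as in the radial symmetry (2); without recentring (3) is false, since translating u_δ far away as δ→0 gives the limit +1 on compact sets. *)

(* Defs.v *)
(* MathComp / MathComp-Analysis *)
From mathcomp Require Import all_boot all_order all_algebra.
From mathcomp Require Import all_classical all_reals all_analysis.
From mathcomp Require Import ring lra.

Set Implicit Arguments.
Unset Strict Implicit.
Unset Printing Implicit Defensive.

Import Order.TTheory GRing.Theory Num.Theory.
Import numFieldNormedType.Exports.

Local Open Scope classical_set_scope.
Local Open Scope ring_scope.

Section Nonlinearity.
Variable R : realType.
Implicit Types d t : R.

Definition delta_max : R := 2 / (3 * Num.sqrt 3).

Definition fdelta d t : R := t - t ^+ 3 - d.

(* [get] picks a point of the set, and an arbitrary real if it is empty;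
   [fdelta_roots] below shows that for |d| < delta_max the three sets are
   singletons and that these are all the real roots. *)
Definition z1 d : R := get [set t | fdelta d t = 0 /\ t < - (Num.sqrt 3)^-1].
Definition z2 d : R :=
  get [set t | fdelta d t = 0 /\ - (Num.sqrt 3)^-1 < t < (Num.sqrt 3)^-1].
Definition z3 d : R := get [set t | fdelta d t = 0 /\ (Num.sqrt 3)^-1 < t].

Lemma fdelta_continuous d : continuous (fdelta d).
Proof.
move=> t; rewrite /fdelta.
apply: cvgB; last exact: cvg_cst.
apply: cvgB; first exact: cvg_id.
exact: exprn_continuous.
Qed.

Lemma fdelta_roots d : - delta_max < d < delta_max ->
  [/\ z1 d < - (Num.sqrt 3)^-1 < z2 d, z2 d < (Num.sqrt 3)^-1 < z3 d &
      forall t, fdelta d t = 0 <-> [\/ t = z1 d, t = z2 d | t = z3 d]].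
Proof.
have q0 : 0 < Num.sqrt 3 :> R by rewrite sqrtr_gt0.
have q2 : Num.sqrt 3 ^+ 2 = 3 :> R by rewrite sqr_sqrtr.
have dE : delta_max = 2 / 3 * (Num.sqrt 3)^-1.
  by rewrite /delta_max; field; rewrite gt_eqF.
rewrite dE /z1 /z2 /z3.
have s0 : 0 < (Num.sqrt 3)^-1 :> R by rewrite invr_gt0.
have s2 : 3 * (Num.sqrt 3)^-1 ^+ 2 = 1 :> R.
  by rewrite exprVn q2 divff.
move: (Num.sqrt 3)^-1 s0 s2 => s s0 s2 /andP[dl du].
have s3 : s ^+ 3 = s / 3 by rewrite exprS; nra.
have s1 : s < 1 by nra.
have fl : fdelta d (- s) < 0 by rewrite /fdelta exprNn s3; lra.
have fr : 0 < fdelta d s by rewrite /fdelta s3; lra.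
have fm2 : 0 < fdelta d (- 2) by rewrite /fdelta; lra.
have f2 : fdelta d 2 < 0 by rewrite /fdelta; lra.
have ivt a b : a <= b ->
    Num.min (fdelta d a) (fdelta d b) <= 0 <=
    Num.max (fdelta d a) (fdelta d b) ->
    exists2 c, a <= c <= b & fdelta d c = 0.
  move=> ab h; have [|c + fc] := @IVT R (fdelta d) a b 0 ab _ h.
    by apply: continuous_subspaceT => x; exact: fdelta_continuous.
  by rewrite in_itv /= => cab; exists c.
have ex1 : exists t, fdelta d t = 0 /\ t < - s.
  have [||c /andP[_ cs] c0] := ivt (- 2) (- s); first by lra.
    by rewrite ge_min le_max (ltW fl) (ltW fm2) ?orbT.
  exists c; split => //; rewrite lt_neqAle cs andbT.
  by apply/eqP => cE; move: fl; rewrite -cE c0 ltxx.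
have ex2 : exists t, fdelta d t = 0 /\ - s < t < s.
  have [||c /andP[sc cs] c0] := ivt (- s) s; first by lra.
    by rewrite ge_min le_max (ltW fl) (ltW fr) ?orbT.
  exists c; split => //; rewrite !lt_neqAle cs sc !andbT.
  apply/andP; split; apply/eqP => cE.
    by move: fl; rewrite cE c0 ltxx.
  by move: fr; rewrite -cE c0 ltxx.
have ex3 : exists t, fdelta d t = 0 /\ s < t.
  have [||c /andP[sc _] c0] := ivt s 2; first by lra.
    by rewrite ge_min le_max (ltW f2) (ltW fr) ?orbT.
  exists c; split => //; rewrite lt_neqAle sc andbT.
  by apply/eqP => cE; move: fr; rewrite cE c0 ltxx.
have [e1 h1] := getPex ex1; have [e2 h2] := getPex ex2.
have [e3 h3] := getPex ex3.
move: (get _) e1 h1 => t1 e1 h1; move: (get _) e2 h2 => t2 e2 /andP[h2 h2'].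
move: (get _) e3 h3 => t3 e3 h3.
split; [by apply/andP|by apply/andP|] => t; split; last by case=> ->.
have H r r' : fdelta d r = 0 -> fdelta d r' = 0 ->
    (r - r') * (1 - (r ^+ 2 + r * r' + r' ^+ 2)) = 0.
  move=> hr hr'; have -> : (r - r') * (1 - (r ^+ 2 + r * r' + r' ^+ 2)) =
    fdelta d r - fdelta d r' by rewrite /fdelta; ring.
  by rewrite hr hr' subrr.
move=> e0.
have [->|n1] := eqVneq t t1; first by constructor.
have [->|n2] := eqVneq t t2; first by constructor.
have [->|n3] := eqVneq t t3; first by constructor.
have K r : fdelta d r = 0 -> t != r -> t ^+ 2 + t * r + r ^+ 2 = 1.
  move=> er nr; move/eqP: (H _ _ e0 er); rewrite mulf_eq0 subr_eq0 (negbTE nr) /=.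
  by rewrite subr_eq0 => /eqP <-.
have k1 := K _ e1 n1; have k2 := K _ e2 n2; have k3 := K _ e3 n3.
have : (t2 - t1) * (t + t1 + t2) = 0 by lra.
have : (t3 - t1) * (t + t1 + t3) = 0 by lra.
move=> /eqP; rewrite mulf_eq0 => /orP[/eqP ?|/eqP ?]; first by lra.
by move=> /eqP; rewrite mulf_eq0 => /orP[/eqP ?|/eqP ?]; lra.
Qed.

End Nonlinearity.

Section Space.
Variables (R : realType) (n : nat).
Local Notation E := 'rV[R]_n.+1.
Implicit Types (x : E) (u : E -> R) (i j : 'I_n.+1).

Definition basis_vec i : E := delta_mx 0 i.

Definition partial i u : E -> R := 'D_(basis_vec i) u.

Definition laplacian u x : R := \sum_i partial i (partial i u) x.

(* The topology on row vectors is that of the sup norm, equivalent to the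
   Euclidean one. *)
(* Classical derivatives: distributional solutions in L^3_loc are smooth. *)
Definition C2 u : Prop :=
  [/\ continuous u,
      forall i, (forall x, derivable u x (basis_vec i)) /\
                continuous (partial i u) &
      forall i j, (forall x, derivable (partial i u) x (basis_vec j)) /\
                  continuous (partial j (partial i u))].

Definition entire_solution d u : Prop :=
  C2 u /\ forall x, - laplacian u x = u x - u x ^+ 3 - d.

(* A point is x = (x', x_N) with N = n.+1; the coordinate x_N has index
   [ord_max]. The norm of x' must be Euclidean, hence is not the library's
   norm on row vectors. *)
Definition xlast x : R := x 0 ord_max.

Definition norm_x' x : R := Num.sqrt (\sum_(i | i != ord_max) x 0 i ^+ 2).

Definition cylinder (r : R) : set E := [set x | norm_x' x < r].

Definition periodic_xlast u : Prop :=
  exists2 T : R, 0 < T & forall x, u (x + T *: basis_vec ord_max) = u x.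

Definition radial_x' u : Prop :=
  exists w : R -> R -> R, forall x, u x = w (norm_x' x) (xlast x).

(* Radial symmetry and convergence to -1 as d -> 0+ only make sense up to
   translation: the equation is invariant under translations, and if u_d is
   recentred at a distance growing fast enough as d -> 0 then it tends to +1
   on compact sets. *)
Definition translate (a : E) u : E -> R := fun x => u (x + a).

End Space.

(* Main.v *)
(** Every estimate below comes from touching a solution by an explicit test
    function on a compact set, where the second derivatives are compared.

    Bounds: the Keller--Osserman barrier gives z1 <= u <= z3, and the Hopf
    barrier turns both inequalities into strict ones for non-constant u.

    Symmetry: wherever u > z2 on a large ball, multiples of
    (p - |x - y|^2)^2 touching u - z2 from below push u(y) up to z3; hence
    u -> z3 as |x'| -> oo, and periodicity in x_N provides compactness. The
    moving plane method then applies in every direction of R^(N-1), since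
    f' < 0 near z3; it also gives that u is minimal on its axis.

    Limit: if u > -1 + 2b everywhere and d << b^2, a compactly supported
    subsolution, equal to -1 + 2b or less on the boundary of its ball and larger
    than 3/5 in the middle, can be slid from infinity to any point, although u
    takes values below z2 < 3/5. So min u -> -1, and the smallness of u - z1 at
    the minimum point spreads to compact sets by the Hopf barrier together with
    a Lipschitz bound independent of d. *)
Require Import Defs.
From mathcomp Require Import all_boot all_order all_algebra.
From mathcomp Require Import all_classical all_reals all_analysis.
From mathcomp Require Import ring lra.

Set Implicit Arguments.
Unset Strict Implicit.
Unset Printing Implicit Defensive.

Import Order.TTheory GRing.Theory Num.Theory.
Import numFieldNormedType.Exports.

Local Open Scope classical_set_scope.
Local Open Scope ring_scope.

(** * Second derivatives along lines *)

Section OneVariable.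
Variable R : realType.
Implicit Types (g h : R -> R) (a b : R).

(** Compactness of the family of solutions is replaced by explicit estimates: radii and constants
    are chosen before the solution, and the Lipschitz constant and the propagation of smallness do
    not depend on [d] either, which is what lets [d] tend to 0. Moving planes yields one symmetry
    hyperplane for each transverse direction, and nothing forces these hyperplanes to meet at first.
    The coordinate ones determine a candidate axis, and every other one is then shown to contain it.
    By periodicity the minimum over the axis is attained; recentring there is what selects the limit
    -1. The heteroclinic [tanh (s / sqrt 2)] solves the equation with [d = 0] exactly, so it has no
    margin left for bending it into a radial bump or for the term [- d]. A correction of order [b^2]
    creates a margin of the same order, which has to pay for both; hence the condition relating [d]
    to [b^2]. *)

Definition has_der2 g b : Prop :=
  exists g' : R -> R,
    (\forall t \near (0 : R), is_derive t (1 : R) g (g' t)) /\ is_derive (0 : R) (1 : R) g' b.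

Lemma has_der2D g h a b :
  has_der2 g a -> has_der2 h b -> has_der2 (fun t => g t + h t) (a + b).
Proof.
move=> [g' [dg dg']] [h' [dh dh']]; exists (g' + h'); split; last exact: is_deriveD.
by near=> t; apply: is_deriveD; near: t.
Unshelve. all: by end_near. Qed.

Lemma has_der2Z c g a : has_der2 g a -> has_der2 (fun t => c * g t) (c * a).
Proof.
move=> [g' [dg dg']]; exists (c \*: g'); split; last exact: is_deriveZ.
by near=> t; apply: is_deriveZ; near: t.
Unshelve. all: by end_near. Qed.

Lemma has_der2_cst c : has_der2 (fun=> c) 0.
Proof.
exists (fun=> 0); split; last exact: is_derive_cst.
by near=> t; exact: is_derive_cst.
Unshelve. all: by end_near. Qed.

(** At a minimum [g' 0 = 0]. If [b] were negative, [g'] would be negative just to the right of 0,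
    and the mean value theorem would give [g t < g 0] there. *)
Lemma has_der2_min g b : has_der2 g b ->
  (\forall t \near (0 : R), g 0 <= g t) -> 0 <= b.
Proof.
move=> [g' [dg dg']] gmin; rewrite leNgt; apply/negP => b0.
have [e /= e0 He] : exists2 e : R, 0 < e & forall t, `|t| < e ->
    is_derive t (1 : R) g (g' t) /\ g 0 <= g t.
  have [e /= e0 He] : \forall t \near (0 : R),
    is_derive t (1 : R) g (g' t) /\ g 0 <= g t by apply: filterI.
  by exists e => // t te; apply: He; rewrite /= sub0r normrN.
have in_e (t : R) : t \in `]- e, e[ -> `|t| < e.
  by rewrite in_itv /= => /andP[t1 t2]; rewrite ltr_norml t1 t2.
have g'0 : g' 0 = 0.
  have d0 : is_derive (0 : R) 1 g (g' 0) by apply: (He 0 _).1; rewrite normr0.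
  have z0 : is_derive (0 : R) 1 g 0.
    apply: (@derive1_at_min _ g (- e) e 0).
    - lra.
    - by move=> t /in_e /He[].
    - by rewrite in_itv /=; apply/andP; split; lra.
    - by move=> t /in_e /He[].
  by rewrite -(@derive_val _ _ _ _ _ _ _ d0) (@derive_val _ _ _ _ _ _ _ z0).
have : \forall t \near (0 : R)^', t^-1 * g' t < 0.
  have [/derivable_nbhsP _ dE] := dg'.
  have : (fun s : R => s^-1 *: ((g' \o shift 0) (s *: (1 : R)) - g' 0)) @ (0 : R)^' --> b.
    by rewrite -dE; case: dg'.
  move=> /cvgr_lt /(_ _ b0); apply: filterS => t /=.
  by rewrite g'0 subr0 addr0 [t *: 1]mulr1.
move=> [r /= r0 Hr].
pose t := Num.min e r / 2.
have m0 : 0 < Num.min e r by rewrite lt_min e0 r0.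
have t0 : 0 < t by rewrite /t; lra.
have me : Num.min e r <= e by rewrite ge_min lexx.
have mr : Num.min e r <= r by rewrite ge_min lexx orbT.
have te : t < e by rewrite /t; lra.
have tr : t < r by rewrite /t; lra.
have dgt s : s \in `]0, t[ -> is_derive s 1 g (g' s).
  rewrite in_itv /= => /andP[s0 st]; apply: (He s _).1.
  by rewrite gtr0_norm //; lra.
have cont : {within `[0, t], continuous g}.
  apply: derivable_within_continuous => s; rewrite in_itv /= => /andP[s0 st].
  by have [|[]] := He s; [rewrite ger0_norm //; lra|].
have [c /[!in_itv]/= /andP[c0 ct] gE] := MVT t0 dgt cont.
have g'c : g' c < 0.
  have : c^-1 * g' c < 0.
    by apply: Hr => /=; rewrite ?gt_eqF // sub0r normrN gtr0_norm //; lra.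
  by rewrite pmulr_rlt0 // invr_gt0.
have : g 0 <= g t by apply: (He t _).2; rewrite gtr0_norm.
by rewrite -subr_ge0 gE subr0 leNgt pmulr_llt0 // g'c.
Qed.

End OneVariable.

(** * Euclidean structure and Laplacians at a point *)

Section EuclideanSpace.
Variables (R : realType) (n : nat).
Local Notation E := 'rV[R]_n.+1.
Implicit Types (x y a : E) (u v f : E -> R) (i j : 'I_n.+1).

Definition dot x y : R := \sum_i x 0 i * y 0 i.

Lemma dotC x y : dot x y = dot y x.
Proof. by apply: eq_bigr => i _; rewrite mulrC. Qed.

Lemma dotDl x y a : dot (x + y) a = dot x a + dot y a.
Proof. by rewrite /dot -big_split; apply: eq_bigr => i _; rewrite mxE mulrDl. Qed.

Lemma dotZl (c : R) x a : dot (c *: x) a = c * dot x a.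
Proof. by rewrite /dot mulr_sumr; apply: eq_bigr => i _; rewrite mxE mulrA. Qed.

Lemma dotNl x a : dot (- x) a = - dot x a.
Proof. by rewrite -scaleN1r dotZl mulN1r. Qed.

Lemma dotDr x y a : dot a (x + y) = dot a x + dot a y.
Proof. by rewrite dotC dotDl !(dotC a). Qed.

Lemma dotZr (c : R) x a : dot a (c *: x) = c * dot a x.
Proof. by rewrite dotC dotZl (dotC a). Qed.

Lemma dotNr x a : dot a (- x) = - dot a x.
Proof. by rewrite dotC dotNl (dotC a). Qed.

Lemma dot0l x : dot 0 x = 0.
Proof. by rewrite -(scale0r x) dotZl mul0r. Qed.

Definition dotE := (dotDl, dotDr, dotNl, dotNr, dotZl, dotZr).

Lemma dot_basis x i : dot x (basis_vec R i) = x 0 i.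
Proof.
rewrite /dot (bigD1 i) //= mxE !eqxx mulr1 big1 ?addr0 // => j ji.
by rewrite mxE (negbTE ji) andbF mulr0.
Qed.

Lemma dot_ge0 x : 0 <= dot x x.
Proof. by apply: sumr_ge0 => i _; rewrite -expr2 sqr_ge0. Qed.

Lemma dot_eq0 x : dot x x = 0 -> x = 0.
Proof.
move=> /eqP; rewrite psumr_eq0 => [|i _]; last by rewrite -expr2 sqr_ge0.
move=> /allP x0; apply/rowP => i; rewrite mxE.
by have := x0 i (mem_index_enum _); rewrite /= mulf_eq0 orbb => /eqP.
Qed.

Lemma coord_sqr_le_dot x i : x 0 i ^+ 2 <= dot x x.
Proof.
rewrite /dot (bigD1 i) //= -expr2 lerDl sumr_ge0 // => j _.
by rewrite -expr2 sqr_ge0.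
Qed.

Lemma cauchy_schwarz_unit x a : dot a a = 1 -> dot x a ^+ 2 <= dot x x.
Proof.
move=> a1; have := dot_ge0 (x - dot x a *: a).
by rewrite !dotE a1 (dotC a x); nra.
Qed.

Lemma continuous_sum_ord (T : topologicalType) (F : 'I_n.+1 -> T -> R) :
  (forall i, continuous (F i)) -> continuous (fun p => \sum_i F i p).
Proof.
move=> cF p; elim: (index_enum _) => [|i r IH].
  by under eq_fun do rewrite big_nil; exact: cvg_cst.
under eq_fun do rewrite big_cons.
by apply: cvgD; [exact: cF|exact: IH].
Qed.

Lemma continuous_dotl a : continuous (dot^~ a).
Proof.
apply: continuous_sum_ord => i x.
have c : (fun p : E => p 0 i) @ x --> x 0 i by exact: (@coord_continuous R 1 n.+1 0 i).
exact: (cvgM c (cvg_cst _)).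
Qed.

Lemma continuous_sqdist a : continuous (fun x => dot (x - a) (x - a)).
Proof.
apply: continuous_sum_ord => i x.
have c : (fun y : E => (y - a) 0 i) @ x --> (x - a) 0 i.
  apply: (@continuous_comp _ _ _ (fun y : E => y - a) (fun y : E => y 0 i)).
    exact: (cvgB cvg_id (cvg_cst _)).
  exact: (@coord_continuous R 1 n.+1 0 i).
exact: (cvgM c c).
Qed.

Lemma min_attained (A : set E) (M : R) f : A !=set0 -> closed A ->
  (forall x, A x -> forall i, `|x 0 i| <= M) ->
  (forall x, A x -> {for x, continuous f}) ->
  exists2 c, A c & forall x, A x -> f c <= f x.
Proof.
move=> A0 Acl Ab fc; have Aco : compact A.
  have Mco : compact [set v : E | forall i, v ord0 i \in `[- M, M]].
    apply: (@rV_compact _ _ (fun=> `[- M, M]%classic)) => _.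
    exact: segment_compact.
  apply: subclosed_compact Acl Mco _ => v Av i.
  by have := Ab v Av i; rewrite ler_norml in_itv.
have cA : {within A, continuous f}.
  by apply: continuous_in_subspaceT => x /set_mem; exact: fc.
have [c cA' cmin] := EVT_min_rV A0 Aco cA.
by exists c; [exact/set_mem|move=> x Ax; apply: cmin; exact/mem_set].
Qed.

(** A notion at the single point [x], so that it applies to test functions singular elsewhere and to
    reflected or translated solutions without a global regularity statement. *)
Definition has_laplacian u x (L : R) : Prop :=
  exists2 c : 'I_n.+1 -> R,
    forall i, has_der2 (fun t => u (x + t *: basis_vec R i)) (c i) &
    \sum_i c i = L.

Lemma has_laplacian_cst (c : R) x : has_laplacian (fun=> c) x 0.
Proof. by exists (fun=> 0); [move=> i; exact: has_der2_cst|rewrite big1]. Qed.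

Lemma has_laplacianD u v x (a b : R) :
  has_laplacian u x a -> has_laplacian v x b ->
  has_laplacian (fun y => u y + v y) x (a + b).
Proof.
move=> [c hc <-] [d hd <-]; exists (fun i => c i + d i); last exact: big_split.
by move=> i; exact: has_der2D.
Qed.

Lemma has_laplacianZ (k : R) u x (a : R) :
  has_laplacian u x a -> has_laplacian (fun y => k * u y) x (k * a).
Proof.
move=> [c hc <-]; exists (fun i => k * c i); last by rewrite mulr_sumr.
by move=> i; exact: has_der2Z.
Qed.

Lemma has_laplacianB u v x (a b : R) :
  has_laplacian u x a -> has_laplacian v x b ->
  has_laplacian (fun y => u y - v y) x (a - b).
Proof.
move=> ha /(has_laplacianZ (-1)) hb; have := has_laplacianD ha hb.
rewrite mulN1r; congr (has_laplacian _ _ _); apply/funext => y.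
by rewrite mulN1r.
Qed.

Lemma cvg_line x y : (fun t : R => x + t *: y) @ (0 : R) --> x.
Proof.
have : (fun t : R => x + t *: y) @ (0 : R) --> x + (0 : R) *: y.
  exact: (cvgD (cvg_cst _) (cvgZr_tmp cvg_id)).
by rewrite scale0r addr0.
Qed.

(** [v - u] has a local minimum at [x], so its second derivative along each axis is non-negative.
    Every comparison below reduces to this one. *)
Lemma touching u v x (a b : R) :
  has_laplacian u x a -> has_laplacian v x b ->
  (\forall y \near x, v x - u x <= v y - u y) -> a <= b.
Proof.
move=> ha hb uv; have [c hc cE] := has_laplacianB hb ha.
rewrite -subr_ge0 -cE; apply: sumr_ge0 => i _.
apply: has_der2_min (hc i) _; rewrite scale0r addr0.
exact: (@cvg_line x (basis_vec R i) _ uv).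
Qed.

Lemma is_derive_line f x a (t D : R) :
  is_derive (x + t *: a) a f D -> is_derive t (1 : R) (fun s => f (x + s *: a)) D.
Proof.
move=> [df <-].
have E : (fun h : R => h^-1 *: ((f \o shift (x + t *: a)) (h *: a) - f (x + t *: a)))
  = (fun h : R => h^-1 *: (((fun s => f (x + s *: a)) \o shift t) (h *: (1 : R))
      - f (x + t *: a))).
  apply/funext => h /=; congr (_ *: (f _ - _)).
  by rewrite [h *: 1]mulr1 scalerDl addrC -addrA [in X in x + X]addrC.
by split; [rewrite /derivable -E|rewrite /derive -E].
Qed.

Lemma mvt_line f (df : E -> R) y a (s : R) : (forall x, is_derive x a f (df x)) ->
  exists2 t, `|t| <= `|s| & f (y + s *: a) - f y = s * df (y + t *: a).
Proof.
move=> fd.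
have d t : is_derive t (1 : R) (fun s => f (y + s *: a)) (df (y + t *: a)).
  by apply: is_derive_line; exact: fd.
have co b c : {within `[b, c], continuous (fun s => f (y + s *: a))}.
  by apply: derivable_within_continuous => t _; case: (d t).
have [s0|s0] := leP 0 s.
  have [t /[!in_itv]/= /andP[t0 ts] E] := MVT_segment s0 (fun t _ => d t) (co 0 s).
  exists t; first by rewrite !ger0_norm.
  by move: E; rewrite scale0r addr0 subr0 mulrC.
have [t /[!in_itv]/= /andP[t0 ts] E] := MVT_segment (ltW s0) (fun t _ => d t) (co s 0).
exists t; first by rewrite !ler0_norm ?lerN2 // ltW.
move: E; rewrite scale0r addr0 sub0r mulrN => E.
by rewrite -opprB E opprK mulrC.
Qed.

(** [C2] only speaks of coordinate directions. The increment along [a + k e_i] is split into one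
    along [a] and one along [e_i]; the mean value theorem turns the latter into [h * k] times a
    partial derivative at a point tending to [x], and continuity of that derivative concludes. *)
Lemma is_derive_add_basis f a (D : E -> R) (k : R) i :
  (forall x, is_derive x a f (D x)) ->
  (forall x, derivable f x (basis_vec R i)) -> continuous (partial i f) ->
  forall x, is_derive x (a + k *: basis_vec R i) f (D x + k * partial i f x).
Proof.
move=> fa fi ci x; set e := basis_vec R i.
have fi' y : is_derive y e f (partial i f y) by exact: derivableP.
have /choice[th thP] (h : R) : exists t, `|t| <= `|h * k| /\
    f (h *: a + x + (h * k) *: e) - f (h *: a + x) =
    (h * k) * partial i f (h *: a + x + t *: e).
  by have [t t1 t2] := mvt_line (h *: a + x) (h * k) fi'; exists t.
suff H : (fun h : R => h^-1 *: ((f \o shift x) (h *: (a + k *: e)) - f x))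
    @ (0 : R)^' --> D x + k * partial i f x.
  by split; [apply/cvg_ex; eexists; exact: H|exact/cvg_lim].
have H1 : (fun h : R => h^-1 *: ((f \o shift x) (h *: a) - f x)) @ (0 : R)^' --> D x.
  by have [c <-] := fa x.
have hk0 : (fun h : R => h * k) @ (0 : R)^' --> (0 : R).
  apply: cvg_within_filter.
  have H : (fun h : R => h * k) @ (0 : R) --> (0 : R) * k.
    exact: (cvgM cvg_id (cvg_cst k)).
  by rewrite mul0r in H.
have th0 : th @ (0 : R)^' --> (0 : R).
  apply/norm_cvg0P; apply: (@squeeze_cvgr _ _ _ _ (fun=> 0) (fun h => `|h * k|)).
  - by near=> h; rewrite normr_ge0 (thP h).1.
  - exact: cvg_cst.
  - by apply/norm_cvg0P.
have H2 : (fun h => partial i f (h *: a + x + th h *: e)) @ (0 : R)^' --> partial i f x.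
  apply: (@cvg_comp _ _ _ (fun h : R => h *: a + x + th h *: e)); last exact: ci.
  have id0 : (fun h : R => h) @ (0 : R)^' --> (0 : R).
    exact: cvg_within.
  have H : (fun h : R => h *: a + x + th h *: e) @ (0 : R)^' --> (0 : R) *: a + x + (0 : R) *: e.
    exact: (cvgD (cvgD (cvgZr_tmp id0) (cvg_cst x)) (cvgZr_tmp th0)).
  by rewrite !scale0r add0r addr0 in H.
have H3 : (fun h : R => h^-1 *: ((f \o shift x) (h *: a) - f x) +
    k * partial i f (h *: a + x + th h *: e)) @ (0 : R)^' --> D x + k * partial i f x.
  exact: (cvgD H1 (cvgM (cvg_cst k) H2)).
apply: cvg_trans H3; apply: near_eq_cvg; near=> h.
have h0 : h != 0 by near: h; exact: nbhs_dnbhs_neq.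
have E1 : h *: (a + k *: e) + x = h *: a + x + (h * k) *: e.
  by rewrite scalerDr scalerA addrAC.
have := (thP h).2; rewrite /= E1 => E2.
rewrite -[in RHS](subrK (f (h *: a + x)) (f _)) E2 /GRing.scale /=.
by field.
Unshelve. all: by end_near. Qed.
End EuclideanSpace.

(** * Laplacians of test functions *)

Section Laplacian.
Variables (R : realType) (n : nat).
Local Notation E := 'rV[R]_n.+1.
Local Notation N := (n.+1%:R : R).
Implicit Types (x y a e : E) (u v f : E -> R) (i j : 'I_n.+1) (F p : R -> R).

Lemma has_der2_comp F F' p p' (b c : R) :
  (\forall s \near p 0, is_derive s (1 : R) F (F' s)) ->
  is_derive (p 0) (1 : R) F' b ->
  (forall t, is_derive t (1 : R) p (p' t)) -> is_derive (0 : R) (1 : R) p' c ->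
  has_der2 (fun t => F (p t)) (b * p' 0 ^+ 2 + F' (p 0) * c).
Proof.
move=> dF dF' dp dp'; exists (fun t => F' (p t) * p' t); split.
  have pc : {for (0 : R), continuous p}.
    by apply/differentiable_continuous/derivable1_diffP; case: (dp 0).
  have := pc _ dF; apply: (@filterS _ (nbhs (0 : R))) => t dFt.
  exact: (@is_derive1_comp _ F p t).
have dFp := @is_derive1_comp _ F' p 0 _ _ dF' (dp 0).
rewrite (_ : _ + _ = (F' \o p) 0 *: c + p' 0 *: (b * p' 0)).
  exact: (is_deriveM dFp dp').
by rewrite /GRing.scale /=; ring.
Qed.

Lemma is_derive_C1 f : (forall i, (forall x, derivable f x (basis_vec R i)) /\
    continuous (partial i f)) ->
  forall a x, is_derive x a f (\sum_i a 0 i * partial i f x).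
Proof.
move=> fC1 a; rewrite {1}(row_sum_delta a).
elim: (index_enum _) => [|i r IH] x.
  by rewrite !big_nil; exact: is_derive0.
rewrite !big_cons addrC [_ * _ + _]addrC.
apply: (@is_derive_add_basis _ _ _ _ (fun x => \sum_(j <- r) a 0 j * partial j f x)).
- by have [] := fC1 i.
- by have [] := fC1 i.
Qed.

Lemma has_der2_C2 u a x : C2 u ->
  has_der2 (fun t => u (x + t *: a))
    (\sum_i \sum_j a 0 i * a 0 j * partial j (partial i u) x).
Proof.
move=> [_ u1 u2].
exists (fun t => \sum_i a 0 i * partial i u (x + t *: a)); split.
  near=> t; apply: is_derive_line; exact: is_derive_C1.
apply: (@is_derive_line _ _ (fun y => \sum_i a 0 i * partial i u y)).
rewrite scale0r addr0.
have -> : (fun y => \sum_i a 0 i * partial i u y) =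
    \sum_i (a 0 i \*: partial i u).
  by apply/funext => y; rewrite fct_sumE.
apply: (@is_derive_eq _ _ _ _ _ _ _
  (\sum_i a 0 i *: \sum_j a 0 j * partial j (partial i u) x)).
  apply: is_derive_sum => i; apply: is_deriveZ.
  by apply: is_derive_C1 => j; exact: u2.
apply: eq_bigr => i _; rewrite /GRing.scale /= mulr_sumr.
by apply: eq_bigr => j _; rewrite mulrA.
Unshelve. all: by end_near. Qed.

Lemma sum_delta (G : 'I_n.+1 -> R) i : \sum_j (i == j)%:R * G j = G i.
Proof.
rewrite (bigD1 i) //= eqxx mul1r big1 ?addr0 // => j ji.
by rewrite eq_sym (negbTE ji) mul0r.
Qed.

Lemma has_laplacian_C2 u x : C2 u -> has_laplacian u x (laplacian u x).
Proof.
move=> uC2; eexists; first by move=> i; exact: has_der2_C2.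
apply: eq_bigr => i _.
under eq_bigr => j _ do under eq_bigr => k _ do
  rewrite !mxE !eqxx /= eq_sym [k == i]eq_sym -mulrA.
under eq_bigr do rewrite -mulr_sumr.
rewrite sum_delta; exact: (sum_delta (fun j => partial j (partial i u) x)).
Qed.

Definition reflect e (l : R) x : E := x - (2 * (dot x e - l)) *: e.

Lemma dot_reflect e l x : dot e e = 1 -> dot (reflect e l x) e = 2 * l - dot x e.
Proof. by move=> e1; rewrite /reflect !dotE e1; ring. Qed.

Lemma reflectK e l : dot e e = 1 -> involutive (reflect e l).
Proof.
move=> e1 x; rewrite {1}/reflect dot_reflect // /reflect.
by apply/rowP => i; rewrite !mxE; ring.
Qed.

Lemma continuous_reflect e l : continuous (reflect e l).
Proof.
move=> z; have c : (fun x => 2 * (dot x e - l)) @ z --> 2 * (dot z e - l).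
  exact: (cvgM (cvg_cst (2 : R)) (cvgB (@continuous_dotl R n e z) (cvg_cst l))).
exact: (cvgB cvg_id (cvgZr_tmp c)).
Qed.

(** The reflected basis vectors [b i] are again orthonormal, and the trace of the Hessian is the
    same in every orthonormal basis. *)
Lemma has_laplacian_reflect u e l x : dot e e = 1 -> C2 u ->
  has_laplacian (u \o reflect e l) x (laplacian u (reflect e l x)).
Proof.
move=> e1 uC2; set y := reflect e l x.
pose b i : E := basis_vec R i - (2 * e 0 i) *: e.
have bE i t : reflect e l (x + t *: basis_vec R i) = y + t *: b i.
  rewrite /y /b /reflect !dotE [dot (basis_vec _ _) _]dotC dot_basis.
  by apply/rowP => j; rewrite !mxE; ring.
eexists.
  move=> i; have := has_der2_C2 (b i) y uC2.
  by under eq_fun => t do rewrite -bE; apply.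
rewrite exchange_big /=.
transitivity (\sum_j \sum_k (j == k)%:R * partial k (partial j u) y).
  apply: eq_bigr => j _; rewrite exchange_big /=; apply: eq_bigr => k _.
  rewrite -mulr_suml; congr (_ * _).
  transitivity (\sum_i ((j == i)%:R * ((k == i)%:R - 2 * e 0 k * e 0 i)
      - (2 * e 0 j * ((k == i)%:R * e 0 i) - 4 * e 0 j * e 0 k * (e 0 i * e 0 i)))).
    apply: eq_bigr => i _; rewrite !mxE !eqxx /=.
    by ring.
  rewrite sumrB sum_delta sumrB -!mulr_sumr sum_delta -/(dot e e) e1 eq_sym.
  by ring.
by apply: eq_bigr => j _; rewrite sum_delta.
Qed.

(** Radial test functions are written in [r - |x - y|^2] rather than in the distance, so that they
    are smooth at the centre too. *)
Lemma has_laplacian_sqdist F F' (b r : R) y x :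
  (\forall s \near r - dot (x - y) (x - y), is_derive s (1 : R) F (F' s)) ->
  is_derive (r - dot (x - y) (x - y)) (1 : R) F' b ->
  has_laplacian (fun x => F (r - dot (x - y) (x - y))) x
    (4 * dot (x - y) (x - y) * b - 2 * N * F' (r - dot (x - y) (x - y))).
Proof.
set z := x - y; set q := r - dot z z => dF dF'.
exists (fun i => b * (- 2 * z 0 i) ^+ 2 + F' q * (- 2)); last first.
  rewrite big_split /= sumr_const card_ord -mulr_natl -mulr_sumr.
  rewrite (_ : \sum_i _ = 4 * dot z z); first by ring.
  by rewrite /dot mulr_sumr; apply: eq_bigr => i _; ring.
move=> i; pose p (t : R) := q - 2 * z 0 i * t - t ^+ 2.
have -> : (fun t => F (r - dot (x + t *: basis_vec R i - y) (x + t *: basis_vec R i - y)))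
   = (fun t => F (p t)).
  apply/funext => t; congr F.
  have ii : basis_vec R i 0 i = 1 by rewrite mxE !eqxx.
  rewrite /p /q addrAC -/z; move: (z) => w.
  by rewrite !dotE [dot (basis_vec _ _) _]dotC !dot_basis ii; ring.
have p0 : p 0 = q by rewrite /p; ring.
rewrite -p0; pose p' (t : R) := - 2 * z 0 i - 2 * t.
have -> : - 2 * z 0 i = p' 0 by rewrite /p'; ring.
apply: has_der2_comp; rewrite ?p0 //.
  move=> t; rewrite /p; apply: is_derive_eq.
  by rewrite /p' /GRing.scale /=; ring.
by rewrite /p'; apply: is_derive_eq; rewrite /GRing.scale /=; ring.
Qed.

Lemma has_laplacian_dot F F' (b : R) e x : dot e e = 1 ->
  (\forall s \near dot x e, is_derive s (1 : R) F (F' s)) ->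
  is_derive (dot x e) (1 : R) F' b ->
  has_laplacian (fun x => F (dot x e)) x b.
Proof.
move=> e1 dF dF'.
exists (fun i => b * e 0 i ^+ 2 + F' (dot x e) * 0); last first.
  rewrite -[RHS]mulr1 -e1 /dot mulr_sumr; apply: eq_bigr => i _; ring.
move=> i; pose p (t : R) := dot x e + e 0 i * t.
have -> : (fun t => F (dot (x + t *: basis_vec R i) e)) = (fun t => F (p t)).
  apply/funext => t; congr F.
  by rewrite /p !dotE [dot (basis_vec _ _) _]dotC dot_basis mulrC.
have p0 : p 0 = dot x e by rewrite /p; ring.
rewrite -p0; pose p' (t : R) := e 0 i.
have -> : e 0 i = p' 0 by [].
apply: has_der2_comp; rewrite ?p0 //.
by move=> t; rewrite /p; apply: is_derive_eq; rewrite /p' /GRing.scale /=; ring.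
Qed.

End Laplacian.

(** * Comparison on balls *)

Section ComparisonOnBalls.
Variables (R : realType) (n : nat).
Local Notation E := 'rV[R]_n.+1.
Local Notation N := (n.+1%:R : R).
Local Notation d2 x y := (dot (x - y) (x - y)).
Implicit Types (x y a e : E) (u v w f : E -> R) (i j : 'I_n.+1).

Lemma near_lt f x (c : R) : {for x, continuous f} -> f x < c ->
  \forall y \near x, f y < c.
Proof. by move=> fc /(cvgr_lt _ fc). Qed.

Lemma near_gt f x (c : R) : {for x, continuous f} -> c < f x ->
  \forall y \near x, c < f y.
Proof. by move=> fc /(cvgr_gt _ fc). Qed.

Lemma near_sqdist_lt x y (r : R) : d2 x y < r -> \forall z \near x, d2 z y < r.
Proof. by apply: (@near_lt (fun z => d2 z y)); exact: continuous_sqdist. Qed.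

Lemma near_dot_gt x e (l : R) : l < dot x e -> \forall z \near x, l < dot z e.
Proof. move=> H; exact: (@near_gt (fun z => dot z e) x l (@continuous_dotl R n e x) H). Qed.

Lemma closed_fun_le f (c : R) : continuous f -> closed [set x | f x <= c].
Proof.
move=> fc; have : closed (f @^-1` [set s | s <= c]).
  by apply: closed_comp => [x _|]; [exact: fc|exact: closed_le].
by [].
Qed.

Lemma closed_fun_ge f (c : R) : continuous f -> closed [set x | c <= f x].
Proof.
move=> fc; have : closed (f @^-1` [set s | c <= s]).
  by apply: closed_comp => [x _|]; [exact: fc|exact: closed_ge].
by [].
Qed.

Lemma sqball_bounded y (r : R) : exists M : R,
  forall x, d2 x y <= r -> forall i, `|x 0 i| <= M.
Proof.
exists (r + 1 + \sum_j `|y 0 j|) => x xr i.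
have z1 : `|(x - y) 0 i| <= r + 1.
  have := le_trans (coord_sqr_le_dot (x - y) i) xr.
  by rewrite -real_normK ?num_real //; nra.
have y1 : `|y 0 i| <= \sum_j `|y 0 j|.
  by rewrite (bigD1 i) //= lerDl sumr_ge0.
have -> : x 0 i = (x - y) 0 i + y 0 i by rewrite !mxE; ring.
by apply: le_trans (ler_normD _ _) _; exact: lerD.
Qed.

Lemma sqball_min y (r : R) f : 0 <= r ->
  (forall x, d2 x y <= r -> {for x, continuous f}) ->
  exists2 c, d2 c y <= r & forall x, d2 x y <= r -> f c <= f x.
Proof.
move=> r0 fc; have [M HM] := sqball_bounded y r.
apply: (@min_attained R n [set x | d2 x y <= r] M) => //.
  by exists y; rewrite /= subrr dot0l.
by apply: closed_fun_le; exact: continuous_sqdist.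
Qed.

(* The Hopf barrier [exp (- a |x - y|^2) - exp (- a p)]; radii are squared. *)
Lemma barrier_lower_bound (C r : R) : 0 <= C -> 0 < r -> exists2 a : R, 0 < a &
  forall w y (p m : R), continuous w ->
  (forall x, d2 x y <= p -> 0 <= w x) ->
  (forall x, d2 x y <= r -> m <= w x) ->
  (forall x, d2 x y < p -> exists2 L, has_laplacian w x L & L <= C * w x) ->
  forall x, d2 x y <= p -> m * (expR (- (a * d2 x y)) - expR (- (a * p))) <= w x.
Proof.
move=> C0 r0.
(* Ensures [1 <= a] and [C + 1 <= 4 a r - 2 N]. Where [|x - y|^2 > r] the barrier [h] has Laplacian
   [k a (4 a |x - y|^2 - 2 N) e], with [e] the exponential, which then exceeds [C k e >= C h]. *)
pose a := 1 + (2 * N + C + 1) / (4 * r).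
have N0 : 0 <= N by exact: ler0n.
have f0 : 0 <= (2 * N + C + 1) / (4 * r) by apply: divr_ge0; lra.
have a1 : 1 <= a by rewrite /a; lra.
have ar : C + 1 <= 4 * a * r - 2 * N.
  have -> : 4 * a * r = 4 * r + (2 * N + C + 1) by rewrite /a; field; rewrite gt_eqF.
  lra.
exists a => [|w y p m wc w0 wm wL]; first by lra.
pose k := m * expR (- (a * p)).
pose h x := k * (expR (a * (p - d2 x y)) - 1).
have hE x : h x = m * (expR (- (a * d2 x y)) - expR (- (a * p))).
  rewrite /h /k [LHS]mulrBr mulr1 [RHS]mulrBr; congr (_ - _).
  by rewrite -mulrA -expRD; congr (_ * expR _); ring.
suff H x : d2 x y <= p -> h x <= w x by move=> x /H; rewrite hE.
have [m0|m0] := leP m 0.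
  move=> xp; apply: le_trans (w0 _ xp); rewrite hE mulr_le0_ge0 // subr_ge0.
  by rewrite ler_expR lerN2 ler_wpM2l //; lra.
have k0 : 0 < k by rewrite mulr_gt0 ?expR_gt0.
have hc : continuous h.
  move=> z; have c1 : {for z, continuous (fun x => a * (p - d2 x y))}.
    exact: (cvgM (cvg_cst a) (cvgB (cvg_cst p) (@continuous_sqdist R n y z))).
  have c2 : (fun x => expR (a * (p - d2 x y))) @ z --> expR (a * (p - d2 z y)).
    exact: (continuous_comp c1 (@continuous_expR R _)).
  exact: (cvgM (cvg_cst k) (cvgB c2 (cvg_cst (1 : R)))).
move=> xp; have p0 : 0 <= p := le_trans (dot_ge0 _) xp.
have [c cp cmin] := @sqball_min y p (fun x => w x - h x) p0
  (fun x _ => cvgB (wc x) (hc x)).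
rewrite -subr_ge0; apply: le_trans (cmin _ xp); rewrite subr_ge0 leNgt.
apply/negP => wh.
have rc : r < d2 c y.
  rewrite ltNge; apply/negP => cr; have := wm _ cr; rewrite leNgt => /negP; apply.
  apply: lt_le_trans wh _; rewrite hE -[leRHS]mulr1 ler_wpM2l //; first exact: ltW.
  have := expR_gt0 (- (a * p)); have : expR (- (a * d2 c y)) <= 1.
    by rewrite -[leRHS]expR0 ler_expR oppr_le0 mulr_ge0 ?dot_ge0 //; lra.
  lra.
have cp' : d2 c y < p.
  rewrite lt_neqAle cp andbT; apply/eqP => cE.
  by move: wh; rewrite hE cE subrr mulr0 ltNge w0.
have [L wL1 wL2] := wL _ cp'.
have dE s : is_derive s (1 : R) (fun s => k * (expR (a * s) - 1)) (k * a * expR (a * s)).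
  by apply: is_derive_eq; rewrite /GRing.scale /=; ring.
have dE' s : is_derive s (1 : R) (fun s => k * a * expR (a * s)) (k * a * a * expR (a * s)).
  by apply: is_derive_eq; rewrite /GRing.scale /=; ring.
have hL : has_laplacian h c (4 * d2 c y * (k * a * a * expR (a * (p - d2 c y)))
    - 2 * N * (k * a * expR (a * (p - d2 c y)))).
  apply: (@has_laplacian_sqdist R n (fun s => k * (expR (a * s) - 1))
    (fun s => k * a * expR (a * s)) _ p y c) => //.
  by near=> s; exact: dE.
have := touching hL wL1; set e := expR (a * (p - d2 c y)).
have e0 : 0 < e by exact: expR_gt0.
have cnear : \forall z \near c, w c - h c <= w z - h z.
  by near=> z; apply: cmin; apply: ltW; near: z; exact: near_sqdist_lt.
move=> /(_ cnear) HL.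
have : C * w c <= C * (k * e).
  rewrite ler_wpM2l //; apply: le_trans (ltW wh) _.
  by rewrite /h ler_wpM2l ?(ltW k0) // -/e; lra.
have : 0 < k * e by rewrite mulr_gt0.
set ke := k * e => ke0 H1.
have : ke * a * (4 * a * d2 c y - 2 * N) <= C * ke.
  by rewrite /ke in H1 *; apply: le_trans (le_trans HL (le_trans wL2 H1)); lra.
have H2 : C + 1 <= 4 * a * d2 c y - 2 * N.
  apply: le_trans ar _; rewrite lerB // ler_wpM2l //; last exact: ltW.
  lra.
have H3 : C + 1 <= a * (4 * a * d2 c y - 2 * N) by nra.
have : ke * (C + 1) <= ke * (a * (4 * a * d2 c y - 2 * N)).
  by rewrite ler_wpM2l //; exact: ltW.
nra.
Unshelve. all: by end_near. Qed.

Lemma near_sqball (P : set E) y : (\forall x \near y, P x) ->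
  exists2 r : R, 0 < r & forall x, d2 x y <= r -> P x.
Proof.
move=> /nbhs_ballP[e /= e0 He]; exists ((e / 2) ^+ 2); first by nra.
move=> x xr; apply: He; split=> // i j; rewrite ord1 /ball /= -normrN opprB.
have := le_trans (coord_sqr_le_dot (x - y) j) xr.
rewrite !mxE -(@real_normK _ (x 0 j - y 0 j)) ?num_real // ler_sqr ?nnegrE //; lra.
Qed.

(** Strong minimum principle: continuity gives a positive lower bound near the centre, and the
    barrier carries it to the whole open ball. *)
Lemma positivity_on_ball (C p : R) w y : 0 <= C -> continuous w ->
  (forall x, d2 x y <= p -> 0 <= w x) -> 0 < w y ->
  (forall x, d2 x y < p -> exists2 L, has_laplacian w x L & L <= C * w x) ->
  forall x, d2 x y < p -> 0 < w x.
Proof.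
move=> C0 wc w0 wy wL x xp.
have [|r r0 Hr] := @near_sqball [set z | w y / 2 < w z] y.
  by apply: near_gt; [exact: wc|lra].
have [a a0 H] := barrier_lower_bound C0 r0.
have Hm z : d2 z y <= r -> w y / 2 <= w z by move=> /Hr /ltW.
apply: lt_le_trans (H _ _ _ _ wc w0 Hm wL _ (ltW xp)).
rewrite mulr_gt0 ?subr_gt0 ?ltr_expR ?ltrN2 ?ltr_pM2l //; lra.
Qed.

End ComparisonOnBalls.

(** * Pointwise estimates for solutions *)

Section Roots.
Variables (R : realType) (d : R).
Hypothesis hd : 0 < d < delta_max R.
Let s : R := (Num.sqrt 3)^-1.

Lemma inv_sqrt3_sqr : s ^+ 2 = 1 / 3.
Proof. by rewrite /s exprVn sqr_sqrtr // div1r. Qed.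

Lemma inv_sqrt3_bounds : 1 / 2 < s < 3 / 5.
Proof.
have := inv_sqrt3_sqr; have : 0 < s by rewrite invr_gt0 sqrtr_gt0.
by move=> s0 s2; apply/andP; split; nra.
Qed.

Lemma delta_max_lt : delta_max R < 2 / 5.
Proof.
have -> : delta_max R = 2 / 3 * s.
  by rewrite /delta_max /s; field; rewrite gt_eqF // sqrtr_gt0.
by have /andP[] := inv_sqrt3_bounds; lra.
Qed.

Lemma roots_of_fdelta :
  [/\ fdelta d (z1 d) = 0, fdelta d (z2 d) = 0 & fdelta d (z3 d) = 0].
Proof.
have hd' : - delta_max R < d < delta_max R by case/andP: hd; lra.
have [_ _ H] := fdelta_roots hd'.
by split; apply/H; [constructor 1|constructor 2|constructor 3].
Qed.

Lemma roots_bounds : [/\ - 1 - d < z1 d < - 1, 0 < z2 d < s & s < z3 d < 1].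
Proof.
have hd' : - delta_max R < d < delta_max R by case/andP: hd; lra.
have [/andP[a1 a2] /andP[a3 a4] _] := fdelta_roots hd'.
have [f1 f2 f3] := roots_of_fdelta.
have s2 := inv_sqrt3_sqr; have /andP[s3 s4] := inv_sqrt3_bounds.
have /andP[d0 _] := hd.
rewrite -/s in a1 a2 a3 a4.
rewrite /fdelta in f1 f2 f3.
move: (z1 d) (z2 d) (z3 d) a1 a2 a3 a4 f1 f2 f3 => t1 t2 t3 a1 a2 a3 a4 f1 f2 f3.
have b1 : t1 < - 1 by rewrite ltNge; apply/negP => ?; nra.
have b2 : 0 < t2 by rewrite ltNge; apply/negP => ?; nra.
have b3 : t3 < 1 by rewrite ltNge; apply/negP => ?; nra.
rewrite b1 b2 b3 a3 a4 !andbT; split => //; nra.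
Qed.

Lemma fdelta_sub (a b : R) :
  fdelta d a - fdelta d b = (a - b) * (1 - (a ^+ 2 + a * b + b ^+ 2)).
Proof. by rewrite /fdelta; ring. Qed.

(** Here [a^2 + a b + b^2] lies in [0, 12], whence the constant 11. *)
Lemma fdelta_lipschitz (a b : R) : `|a| <= 2 -> `|b| <= 2 ->
  `|fdelta d a - fdelta d b| <= 11 * `|a - b|.
Proof.
rewrite fdelta_sub normrM mulrC => /ler_normlP[a1 a2] /ler_normlP[b1 b2].
apply: ler_wpM2r => //; rewrite ler_norml; apply/andP; split; nra.
Qed.

(** The roots sum to zero, so [f t = (t - z2) (z3 - t) (t + z2 + z3)]; the second factor is at least
    [h] and the third exceeds [z3]. *)
Lemma fdelta_gt_linear (t h : R) : z2 d < t -> t <= z3 d - h -> 0 < h ->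
  (t - z2 d) * (h * z3 d) < fdelta d t.
Proof.
move=> t2 t3 h0; have [_ f2 f3] := roots_of_fdelta.
have [_ /andP[b1 b2] /andP[b3 b4]] := roots_bounds.
have E : 1 = z3 d ^+ 2 + z3 d * z2 d + z2 d ^+ 2.
  have := fdelta_sub (z3 d) (z2 d); rewrite f2 f3 subrr => /esym/eqP.
  by rewrite mulf_eq0 subr_eq0 gt_eqF /=; [move/eqP; lra|lra].
have -> : fdelta d t = (t - z2 d) * ((z3 d - t) * (z3 d + t + z2 d)).
  by rewrite -[LHS]subr0 -f2 fdelta_sub {1}E; ring.
rewrite ltr_pM2l ?subr_gt0 //; nra.
Qed.

End Roots.

(** * A priori estimates by touching *)

Section SolutionEstimates.
Variables (R : realType) (n : nat).
Local Notation E := 'rV[R]_n.+1.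
Local Notation N := (n.+1%:R : R).
Local Notation d2 x y := (dot (x - y) (x - y)).
Implicit Types (x y a e : E) (u v w : E -> R) (i j : 'I_n.+1).

(* Keller--Osserman: [B / (p - |x - y|^2)] with [B] maximal touches [w]. *)
Lemma cubic_subsolution_le0 w : continuous w ->
  (forall x, 0 < w x -> exists2 L, has_laplacian w x L & w x ^+ 3 <= L) ->
  forall y, w y <= 0.
Proof.
move=> wc wL y; rewrite leNgt; apply/negP => m0.
have N0 : 0 <= N by exact: ler0n.
(* Touching will give [B^2 <= (8 + 2 N) p], while the value at the centre gives [w y * p <= B];
   together [w y ^ 2 * p <= 8 + 2 N], which this [p] violates by one unit. *)
pose p : R := (9 + 2 * N) / w y ^+ 2.
have p0 : 0 < p by rewrite divr_gt0 ?exprn_gt0 //; lra.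
have pE : w y ^+ 2 * p = 9 + 2 * N by rewrite /p; field; rewrite gt_eqF.
have cont : continuous (fun x => - (w x * (p - d2 x y))).
  move=> z.
  exact: (cvgN (cvgM (wc z) (cvgB (cvg_cst p) (@continuous_sqdist R n y z)))).
have [c cp cmin] := @sqball_min R n y p _ (ltW p0) (fun x _ => cont x).
pose B := w c * (p - d2 c y).
have Bmax x : d2 x y <= p -> w x * (p - d2 x y) <= B by move=> /cmin; rewrite lerN2.
have BE : w y * p <= B by have := Bmax y; rewrite subrr dot0l subr0; apply; exact: ltW.
have B0 : 0 < B by apply: lt_le_trans BE; rewrite mulr_gt0.
have qc : 0 < p - d2 c y.
  rewrite lt_neqAle subr_ge0 cp andbT; apply/eqP => q0.
  by move: B0; rewrite /B -q0 mulr0 ltxx.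
have wc0 : 0 < w c by move: B0; rewrite /B pmulr_lgt0.
have [L wL1 wL2] := wL _ wc0.
set q := p - d2 c y in qc *.
have dF s : s != 0 -> is_derive s (1 : R) (fun s : R => B * s^-1) (- (B * s ^- 2)).
  move=> s0; have ? : is_derive s (1 : R) (fun s : R => s^-1) (- s ^- 2).
    by have := @is_deriveV R id s 1 1 s0 _; rewrite /GRing.scale /= mulr1; apply.
  by apply: is_derive_eq; rewrite /GRing.scale /=; ring.
have dF' : is_derive q (1 : R) (fun s : R => - (B * s ^- 2)) (2 * B * q ^- 3).
  have q0 : q ^+ 2 != 0 by rewrite expf_neq0 // gt_eqF.
  have ? : is_derive q (1 : R) (fun s : R => s ^- 2) (- (q ^+ 2) ^- 2 *: (2 * q)).
    have ? : is_derive q (1 : R) (fun s : R => s ^+ 2) (2 * q).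
      by apply: is_derive_eq; rewrite /GRing.scale /=; ring.
    exact: (@is_deriveV R (fun s => s ^+ 2) q (2 * q) 1).
  by apply: is_derive_eq; rewrite /GRing.scale /=; field; rewrite gt_eqF.
have hL : has_laplacian (fun x => B * (p - d2 x y)^-1) c
    (4 * d2 c y * (2 * B * q ^- 3) - 2 * N * (- (B * q ^- 2))).
  apply: (@has_laplacian_sqdist R n (fun s => B * s^-1)
    (fun s : R => - (B * s ^- 2)) _ p y c) => //.
  near=> s; apply: dF; apply: lt0r_neq0; near: s.
  exact: lt_nbhsr.
have : L <= 4 * d2 c y * (2 * B * q ^- 3) - 2 * N * (- (B * q ^- 2)).
  apply: (touching wL1 hL); near=> z.
  have zp : d2 z y < p.
    by near: z; apply: near_sqdist_lt; rewrite -subr_gt0.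
  rewrite -/q (_ : w c = B * q^-1); last by rewrite /B -/q mulfK // gt_eqF.
  rewrite subrr subr_ge0 -ler_pdivrMr ?invr_gt0 ?subr_gt0 // invrK.
  exact/Bmax/ltW.
have dq : d2 c y = p - q by rewrite /q; ring.
have -> : 4 * d2 c y * (2 * B * q ^- 3) - 2 * N * (- (B * q ^- 2)) =
    B * q ^- 3 * (8 * (p - q) + 2 * N * q).
  by rewrite dq; field; rewrite gt_eqF.
move=> H; have := le_trans wL2 H.
have -> : w c = B / q by rewrite /B -/q mulfK // gt_eqF.
have -> : (B / q) ^+ 3 = B * q ^- 3 * B ^+ 2 by field; rewrite gt_eqF.
rewrite ler_pM2l; last by rewrite mulr_gt0 // invr_gt0 exprn_gt0.
have qp : q <= p by rewrite /q gerBl dot_ge0.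
move=> H2; have : B ^+ 2 <= (8 + 2 * N) * p by nra.
have : (w y * p) ^+ 2 <= B ^+ 2 by rewrite ler_sqr ?nnegrE //; [nra|exact: ltW].
rewrite exprMn [p ^+ 2]expr2 mulrA pE; nra.
Unshelve. all: by end_near. Qed.

(* Gilbarg--Trudinger, section 3.4: compare the odd part of [u] with respect to
   the mid-hyperplane with [2 M |x - y|^2 + A t (1 - t)], [t] the distance to it. *)
Lemma lipschitz_of_bounded_laplacian (M G : R) : 0 <= M -> 0 <= G ->
  exists2 L : R, 0 < L & forall u, C2 u -> (forall x, `|u x| <= M) ->
  (forall x, `|laplacian u x| <= G) ->
  forall y e (t : R), dot e e = 1 -> `|u (y + t *: e) - u y| <= L * `|t|.
Proof.
move=> M0 G0; have N0 : 0 <= N by exact: ler0n.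
(* Makes the Laplacian [4 M N - 2 A] of the comparison function equal to [- 2 G - 2], strictly below
   that of the odd part, which is at least [- 2 G]. *)
pose A := G + 2 * M * N + 1.
have A0 : 0 < A by rewrite /A; nra.
suff H u : C2 u -> (forall x, `|u x| <= M) -> (forall x, `|laplacian u x| <= G) ->
    forall y e (t : R), dot e e = 1 -> 0 <= t <= 1 ->
    u (y + t *: e) - u (y - t *: e) <= (2 * M + A) * t.
  exists (2 * M + A); first by lra.
  move=> u uC uM uG.
  have H1 y e t : dot e e = 1 -> 0 <= t ->
      u (y + t *: e) - u (y - t *: e) <= (2 * M + A) * (2 * t).
    move=> e1 t0; have [t1|t1] := leP t 1.
      by apply: le_trans (H u uC uM uG y e t e1 _) _; [rewrite t0|nra].
    have := uM (y + t *: e); have := uM (y - t *: e).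
    by rewrite !ler_norml => /andP[? ?] /andP[? ?]; nra.
  have H2 y e t : dot e e = 1 -> 0 <= t ->
      `|u (y + t *: e) - u y| <= (2 * M + A) * t.
    move=> e1 t0; have t0' : 0 <= t / 2 by lra.
    have E1 : y + (t / 2) *: e + (t / 2) *: e = y + t *: e.
      by apply/rowP => k; rewrite !mxE; field.
    have E2 : y + (t / 2) *: e - (t / 2) *: e = y by rewrite addrK.
    have := H1 (y + (t / 2) *: e) e (t / 2) e1 t0'.
    have := H1 (y + (t / 2) *: e) (- e) (t / 2) _ t0'.
    rewrite dotNl dotNr opprK => /(_ e1).
    rewrite scalerN opprK E1 E2 (_ : 2 * (t / 2) = t); last by field.
    move=> h1 h2.
    by rewrite ler_norml; lra.
  move=> y e t e1; have [t0|t0] := leP 0 t; first by rewrite [`|t|]ger0_norm ?H2.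
  rewrite [`|t|]ltr0_norm // (_ : t *: e = - t *: - e).
    by apply: H2; [rewrite dotNl dotNr opprK|lra].
  by rewrite scalerN scaleNr opprK.
move=> uC uM uG y e t e1 /andP[t0 t1].
pose l := dot y e.
pose g x := u x - u (reflect e l x).
pose F (s : R) := 2 * M * (1 - s).
pose K (s : R) := A * ((s - l) - (s - l) ^+ 2).
pose ps x := F (1 - d2 x y) + K (dot x e).
have psE x : ps x = 2 * M * d2 x y + A * (dot (x - y) e - dot (x - y) e ^+ 2).
  have -> : dot (x - y) e = dot x e - l by rewrite dotDl dotNl.
  by rewrite /ps /F /K; ring.
have [c1 c2 _] := uC.
have psL x : has_laplacian ps x (4 * M * N - 2 * A).
  have -> : 4 * M * N - 2 * A = (4 * d2 x y * 0 - 2 * N * (- 2 * M)) + (- 2 * A).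
    by ring.
  apply: has_laplacianD.
    apply: (@has_laplacian_sqdist R n F (fun=> - 2 * M)).
    by near=> s; rewrite /F; apply: is_derive_eq; rewrite /GRing.scale /=; ring.
  apply: (@has_laplacian_dot R n K (fun s => A * (1 - 2 * (s - l)))) => //.
    by near=> s; rewrite /K; apply: is_derive_eq; rewrite /GRing.scale /=; ring.
  by apply: is_derive_eq; rewrite /GRing.scale /=; ring.
have e_dist x : dot (x - y) e ^+ 2 <= d2 x y by exact: cauchy_schwarz_unit.
have lE x : dot x e - l = dot (x - y) e by rewrite dotDl dotNl.
have gc : continuous g.
  move=> z; have := continuous_comp (@continuous_reflect R n e l z) (c1 _).
  by move=> cr; exact: (cvgB (c1 z) cr).
have psc : continuous ps.
  move=> z; have c3 : (fun x => F (1 - d2 x y)) @ z --> F (1 - d2 z y).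
    exact: (cvgM (cvg_cst (2 * M)) (cvgB (cvg_cst (1 : R))
      (cvgB (cvg_cst (1 : R)) (@continuous_sqdist R n y z)))).
  have c4 : (fun x => dot x e - l) @ z --> dot z e - l.
    exact: (cvgB (@continuous_dotl R n e z) (cvg_cst l)).
  exact: (cvgD c3 (cvgM (cvg_cst A) (cvgB c4 (cvgM c4 c4)))).
pose D := [set x : E | d2 x y <= 1] `&` [set x | l <= dot x e].
have [B HB] := sqball_bounded y 1.
have [||x [/HB]//|x _|c [/= cy ce] cmin] := @min_attained R n D B (fun x => ps x - g x).
- by exists y; split => /=; rewrite ?subrr ?dot0l.
- by apply: closedI; [apply: closed_fun_le; exact: continuous_sqdist
    |apply: closed_fun_ge; exact: continuous_dotl].
- exact: (cvgB (psc x) (gc x)).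
(* A negative minimum cannot lie on the hyperplane, where [g] vanishes, nor on the unit sphere,
   where [ps >= 2 M >= g]; inside, the Laplacians contradict each other. *)
have ps0 : 0 <= ps c - g c.
  rewrite leNgt; apply/negP => neg.
  have te := e_dist c; rewrite -lE in te.
  have [tau0|tau0] := eqVneq (dot c e) l.
    move: neg; rewrite /g (_ : reflect e l c = c).
      rewrite subrr subr0 psE -lE tau0 subrr expr0n /= subrr mulr0 addr0.
      by rewrite ltNge !mulr_ge0 ?dot_ge0.
    by rewrite /reflect tau0 subrr mulr0 scale0r subr0.
  have tau1 : 0 < dot c e - l by rewrite subr_gt0 lt_neqAle eq_sym tau0.
  have [cb|cb] := ltP (d2 c y) 1; last first.
    have d1 : d2 c y = 1 by apply/eqP; rewrite eq_le cy cb.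
    rewrite psE -lE d1 in neg te.
    have [_ ?] := ler_normlP _ _ (uM c).
    have [? _] := ler_normlP _ _ (uM (reflect e l c)).
    have tau2 : dot c e - l <= 1 by nra.
    have : 0 <= A * (dot c e - l - (dot c e - l) ^+ 2).
      by rewrite mulr_ge0 ?(ltW A0) //; nra.
    by move: neg; rewrite /g; lra.
  have gL : has_laplacian g c (laplacian u c - laplacian u (reflect e l c)).
    by apply: has_laplacianB; [exact: has_laplacian_C2|exact: has_laplacian_reflect].
  have : laplacian u c - laplacian u (reflect e l c) <= 4 * M * N - 2 * A.
    apply: (touching gL (psL c)); near=> z; apply: cmin; split => /=.
      by apply: ltW; near: z; exact: near_sqdist_lt.
    by apply: ltW; near: z; apply: near_dot_gt; rewrite -subr_gt0.
  have [h1 _] := ler_normlP _ _ (uG c).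
  have [_ h2] := ler_normlP _ _ (uG (reflect e l c)).
  have AE : 4 * M * N - 2 * A = - 2 * G - 2 by rewrite /A; ring.
  move: h1 h2; rewrite AE; move: (laplacian u c) (laplacian u _).
  by clear => a1 a2 h1 h2 h3; lra.
have yt : d2 (y + t *: e) y = t ^+ 2.
  by rewrite addrAC subrr add0r !dotE e1; ring.
have ye : dot (y + t *: e) e - l = t by rewrite !dotE e1 /l; ring.
have : ps c - g c <= ps (y + t *: e) - g (y + t *: e).
  apply: cmin; split; rewrite /= ?yt; first by nra.
  by rewrite -subr_ge0 ye.
rewrite (psE (y + _)) yt -lE ye [g (_ + _)]/g.
have -> : reflect e l (y + t *: e) = y - t *: e.
  by rewrite /reflect ye; apply/rowP => k; rewrite !mxE; ring.
have : 0 <= M * (t - t ^+ 2) by rewrite mulr_ge0 //; nra.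
have : 0 <= A * t ^+ 2 by rewrite mulr_ge0 ?sqr_ge0 ?(ltW A0).
lra.
Unshelve. all: by end_near. Qed.

(** The radius is independent of [u] and of the centre. The estimate is obtained at the contact
    point and passes to [y] because the test function is largest at its centre. *)
Lemma lower_bound_on_ball (d h : R) : 0 < d < delta_max R -> 0 < h ->
  exists2 p : R, 0 < p & forall u, entire_solution d u -> forall y,
    (forall x, d2 x y <= p -> z2 d < u x) -> z3 d - h <= u y.
Proof.
move=> hd h0; have N0 : 0 <= N by exact: ler0n.
have [_ /andP[b1 b2] /andP[b3 b4]] := roots_bounds hd.
pose la := h * z3 d / 2.
have hz : 0 < h * z3 d by rewrite mulr_gt0 //; lra.
have la0 : 0 < la by rewrite /la; lra.
(* The discriminant of [la q^2 - (4 N + 8) q + 8 p] vanishes, so this quadratic is never negative.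
   It is what remains of the comparison of Laplacians once [f (u c)] is bounded below by
   [2 la s]. *)
pose p := (4 * N + 8) ^+ 2 / (32 * la).
have p0 : 0 < p by rewrite divr_gt0 ?exprn_gt0 //; lra.
have pE : (4 * N + 8) ^+ 2 = 32 * la * p by rewrite /p; field; rewrite gt_eqF.
exists p => // u [uC ueq] y uy; have [uc _ _] := uC.
pose q x := p - d2 x y.
have cont x : d2 x y <= p -> {for x, continuous (fun x => - (q x ^+ 2 / (u x - z2 d)))}.
  move=> /uy ux.
  have c1 : q @ x --> q x by exact: (cvgB (cvg_cst p) (@continuous_sqdist R n y x)).
  have c2 : (fun x => (u x - z2 d)^-1) @ x --> (u x - z2 d)^-1.
    have ux0 : u x - z2 d != 0 by rewrite gt_eqF // subr_gt0.
    exact: (cvgV ux0 (cvgB (uc x) (cvg_cst (z2 d)))).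
  exact: (cvgN (cvgM (cvgM c1 c1) c2)).
have [c cp cmin] := @sqball_min R n y p _ (ltW p0) cont.
have yp : d2 y y <= p by rewrite subrr dot0l ltW.
have qy : q y = p by rewrite /q subrr dot0l subr0.
pose s := u c - z2 d; have s0 : 0 < s by rewrite subr_gt0 uy.
have sy : 0 < u y - z2 d by rewrite subr_gt0 uy.
(* The maximum of [q^2 / (u - z2)]: [q^2 / k] touches [u - z2] from below at [c]. *)
pose k := q c ^+ 2 / s.
have kmax x : d2 x y <= p -> q x ^+ 2 <= k * (u x - z2 d).
  move=> xp; have := cmin _ xp; rewrite lerN2 -/s -/k => H.
  by rewrite -ler_pdivrMr // subr_gt0 uy.
have ky : p ^+ 2 <= k * (u y - z2 d) by rewrite -[in leLHS]qy; exact: kmax.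
have k0 : 0 < k.
  by rewrite -(pmulr_lgt0 _ sy); apply: lt_le_trans ky; rewrite exprn_gt0.
have kE : q c ^+ 2 = k * s by rewrite /k divfK // gt_eqF.
have qc : 0 < q c.
  rewrite lt_neqAle subr_ge0 cp andbT; apply/eqP => q0.
  by move: (mulr_gt0 k0 s0); rewrite -kE -q0 expr0n ltxx.
have sbig : z3 d - z2 d - h < s.
  rewrite ltNge; apply/negP => ss.
  have fb : s * (h * z3 d) < fdelta d (u c).
    by apply: fdelta_gt_linear => //; [exact: uy|rewrite /s in ss; lra].
  have qL : has_laplacian (fun x => k^-1 * q x ^+ 2) c
      (4 * d2 c y * (2 * k^-1) - 2 * N * (2 * k^-1 * q c)).
    apply: (@has_laplacian_sqdist R n (fun s : R => k^-1 * s ^+ 2) (fun s => 2 * k^-1 * s)).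
      by near=> x; apply: is_derive_eq; rewrite /GRing.scale /=; ring.
    by apply: is_derive_eq; rewrite /GRing.scale /=; ring.
  have : 4 * d2 c y * (2 * k^-1) - 2 * N * (2 * k^-1 * q c) <= laplacian u c.
    apply: (touching qL (has_laplacian_C2 c uC)); near=> x.
    have xp : d2 x y <= p.
      by apply: ltW; near: x; apply: near_sqdist_lt; rewrite -subr_gt0.
    rewrite kE mulKf ?gt_eqF // {1}/s opprB addrC subrK.
    have := kmax _ xp; rewrite -ler_pdivrMl //; lra.
  have -> : laplacian u c = - fdelta d (u c) by rewrite /fdelta -ueq opprK.
  have -> : d2 c y = p - q c by rewrite /q; ring.
  have -> : 4 * (p - q c) * (2 * k^-1) - 2 * N * (2 * k^-1 * q c) =
    k^-1 * (8 * p - (4 * N + 8) * q c) by field; rewrite gt_eqF.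
  have sE : s = k^-1 * q c ^+ 2 by rewrite kE mulKf // gt_eqF.
  have : - (la * q c ^+ 2) <= 8 * p - (4 * N + 8) * q c.
    have : 0 <= (2 * la * q c - (4 * N + 8)) ^+ 2 by exact: sqr_ge0.
    move: pE; set m := 4 * N + 8 => pE sq.
    by rewrite -(ler_pM2l la0); nra.
  have k0' : 0 <= k^-1 by rewrite invr_ge0 ltW.
  move=> /(ler_wpM2l k0') H1 H2.
  have : s * (h * z3 d) = 2 * (k^-1 * (la * q c ^+ 2)).
    by rewrite sE /la; field; rewrite gt_eqF.
  have := mulr_gt0 s0 hz; rewrite mulrN in H1; lra.
have qp : q c ^+ 2 <= p ^+ 2.
  by rewrite ler_sqr ?nnegrE ?(ltW qc) ?(ltW p0) // gerBl dot_ge0.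
have : s <= u y - z2 d by rewrite -(ler_pM2l k0) -kE; exact: le_trans qp ky.
lra.
Unshelve. all: by end_near. Qed.

End SolutionEstimates.

(** * Bounds for solutions and strong minimum principles *)

Section SolutionBounds.
Variables (R : realType) (n : nat).
Local Notation E := 'rV[R]_n.+1.
Local Notation d2 x y := (dot (x - y) (x - y)).
Implicit Types (x y a e : E) (u v w : E -> R) (d l : R).

Lemma has_laplacian_solution d u x : entire_solution d u ->
  has_laplacian u x (- fdelta d (u x)).
Proof.
move=> [uC ueq]; rewrite -[X in has_laplacian _ _ X]opprK.
by rewrite {1}/fdelta -ueq !opprK; exact: has_laplacian_C2.
Qed.

Lemma has_laplacian_subr u x c L : has_laplacian u x L ->
  has_laplacian (fun y => u y - c) x L.
Proof.
by move=> uL; rewrite -[L]subr0; apply: has_laplacianB => //; exact: has_laplacian_cst.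
Qed.

Lemma has_laplacian_subl u x c L : has_laplacian u x L ->
  has_laplacian (fun y => c - u y) x (- L).
Proof.
by move=> uL; rewrite -[- L]sub0r; apply: has_laplacianB => //; exact: has_laplacian_cst.
Qed.

(** With [w = u - z3 > 0] one has [- f (z3 + w) = w^3 + 3 z3 w^2 + (3 z3^2 - 1) w], and the last two
    terms are non-negative because [z3 > 1 / sqrt 3]. *)
Lemma solution_le_z3 d u : 0 < d < delta_max R -> entire_solution d u ->
  forall x, u x <= z3 d.
Proof.
move=> hd us x; rewrite -subr_le0; move: x; have [[uc _ _] _] := us.
apply: cubic_subsolution_le0 => [z|x]; first exact: (cvgB (uc z) (cvg_cst (z3 d))).
set w := u x - z3 d => w0; exists (- fdelta d (u x)).
  exact/has_laplacian_subr/has_laplacian_solution.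
have [_ _ f3] := roots_of_fdelta hd; have [_ _ /andP[b1 _]] := roots_bounds hd.
have s2 := @inv_sqrt3_sqr R; have /andP[s3 _] := inv_sqrt3_bounds R.
have := fdelta_sub d (u x) (z3 d); rewrite f3 subr0 => ->.
rewrite (_ : u x = z3 d + w); last by rewrite /w addrC subrK.
have : 1 / 3 <= z3 d ^+ 2 by rewrite -s2 ler_sqr ?nnegrE; lra.
have : 0 < z3 d by lra.
by move: (z3 d) => t t0 t2; rewrite -subr_ge0 (_ : _ - _ = w * (3 * t ^+ 2 - 1 + 3 * t * w));
  [rewrite mulr_ge0 ?(ltW w0) //; nra|ring].
Qed.

Lemma solution_ge_z1 d u : 0 < d < delta_max R -> entire_solution d u ->
  forall x, z1 d <= u x.
Proof.
move=> hd us x; rewrite -subr_le0; move: x; have [[uc _ _] _] := us.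
apply: cubic_subsolution_le0 => [z|x]; first exact: (cvgB (cvg_cst (z1 d)) (uc z)).
set w := z1 d - u x => w0; exists (fdelta d (u x)).
  rewrite -[fdelta _ _]opprK; exact/has_laplacian_subl/has_laplacian_solution.
have [f1 _ _] := roots_of_fdelta hd; have [/andP[_ b1] _ _] := roots_bounds hd.
have := fdelta_sub d (u x) (z1 d); rewrite f1 subr0 => ->.
rewrite (_ : u x = z1 d - w); last by rewrite /w opprB addrC subrK.
move: (z1 d) b1 => t b1; rewrite -subr_ge0.
rewrite (_ : _ - _ = w * (3 * t ^+ 2 - 1 - 3 * t * w)); last by ring.
by rewrite mulr_ge0 ?(ltW w0) //; nra.
Qed.

Lemma solution_abs_le2 d u : 0 < d < delta_max R -> entire_solution d u ->
  forall x, `|u x| <= 2.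
Proof.
move=> hd us x; have := solution_le_z3 hd us x; have := solution_ge_z1 hd us x.
have [/andP[? _] _ /andP[_ ?]] := roots_bounds hd; have := delta_max_lt R.
by case/andP: hd => ? ? ? ? ?; rewrite ler_norml; lra.
Qed.

Lemma solution_lipschitz : exists2 L : R, 0 < L &
  forall d u, 0 < d < delta_max R -> entire_solution d u ->
  forall y e (t : R), dot e e = 1 -> `|u (y + t *: e) - u y| <= L * `|t|.
Proof.
(* Both bounds are free of [d]: [|u| <= 2], and [|f u| = |f u - f z3| <= 11 (2 + 2)]. *)
have [L L0 HL] := @lipschitz_of_bounded_laplacian R n 2 44 (ler0n _ _) (ler0n _ _).
exists L => // d u hd us; have u2 := solution_abs_le2 hd us; have [uC ueq] := us.
apply: HL => // x; have -> : laplacian u x = - fdelta d (u x).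
  by rewrite /fdelta -ueq opprK.
have [_ _ f3] := roots_of_fdelta hd; have [_ _ /andP[b1 b2]] := roots_bounds hd.
have /andP[s3 _] := inv_sqrt3_bounds R.
have z2 : `|z3 d| <= 2 by rewrite ler_norml; lra.
rewrite normrN -[fdelta _ _]subr0 -f3.
apply: le_trans (fdelta_lipschitz d (u2 x) z2) _.
have := ler_normB (u x) (z3 d); have := u2 x; lra.
Qed.

(** [u - z1] and [z3 - u] are non-negative with Laplacian at most 11 times themselves; if one of
    them vanishes at a point, the strong minimum principle makes it vanish everywhere. *)
Lemma solution_bounds d u : 0 < d < delta_max R -> entire_solution d u ->
  ~ (exists c, forall x, u x = c) -> forall x, z1 d < u x < z3 d.
Proof.
move=> hd us ncst x; have [[uc _ _] _] := us.
have [f1 _ f3] := roots_of_fdelta hd.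
have u2 := solution_abs_le2 hd us.
have [/andP[? ?] _ /andP[? ?]] := roots_bounds hd; have := delta_max_lt R.
have /andP[s3 _] := inv_sqrt3_bounds R; have /andP[? ?] := hd => dm.
have z1n : `|z1 d| <= 2 by rewrite ler_norml; lra.
have z3n : `|z3 d| <= 2 by rewrite ler_norml; lra.
have prop w : continuous w -> (forall y, 0 <= w y) ->
    (forall y, exists2 L, has_laplacian w y L & L <= 11 * w y) ->
    w x <= 0 -> forall y, w y = 0.
  move=> wc w0 wL wx y; apply/eqP; rewrite eq_le w0 andbT leNgt; apply/negP => wy.
  have C0 : 0 <= 11 :> R by exact: ler0n.
  have : d2 x y < d2 x y + 1 by lra.
  move=> /(positivity_on_ball C0 wc (fun z _ => w0 z) wy (fun z _ => wL z)).
  by rewrite ltNge wx.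
apply/andP; split; rewrite ltNge; apply/negP => ux; apply: ncst.
- exists (z1 d) => y; apply/eqP; rewrite -subr_eq0; apply/eqP; move: y.
  apply: prop => [z|z|z|]; last by rewrite subr_le0.
  + exact: (cvgB (uc z) (cvg_cst (z1 d))).
  + by rewrite subr_ge0 solution_ge_z1.
  + exists (- fdelta d (u z)); first exact/has_laplacian_subr/has_laplacian_solution.
    rewrite -[leLHS]subr0 -opprD -[in leLHS]f1.
    have := fdelta_lipschitz d (u2 z) z1n.
    rewrite [`|u z - _|]ger0_norm ?subr_ge0 ?solution_ge_z1 //.
    by rewrite f1 subr0 addr0 => /ler_normlP[].
- exists (z3 d) => y; apply/esym/eqP; rewrite -subr_eq0; apply/eqP; move: y.
  apply: prop => [z|z|z|]; last by rewrite subr_le0.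
  + exact: (cvgB (cvg_cst (z3 d)) (uc z)).
  + by rewrite subr_ge0 solution_le_z3.
  + exists (fdelta d (u z)).
      rewrite -[fdelta _ _]opprK; exact/has_laplacian_subl/has_laplacian_solution.
    have := fdelta_lipschitz d (u2 z) z3n.
    rewrite distrC [`|u z - _|]distrC [`|z3 d - _|]ger0_norm ?subr_ge0 ?solution_le_z3 //.
    by rewrite f3 sub0r normrN => /ler_normlP[].
Qed.

(** Positivity travels along a chain of balls centred on the segment from [y] to [x], whose common
    radius [r] keeps them in the half-space. *)
Lemma positivity_on_half_space (C l : R) w e : 0 <= C -> dot e e = 1 ->
  continuous w -> (forall x, l <= dot x e -> 0 <= w x) ->
  (forall x, l < dot x e -> exists2 L, has_laplacian w x L & L <= C * w x) ->
  forall y, l < dot y e -> 0 < w y -> forall x, l < dot x e -> 0 < w x.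
Proof.
move=> C0 e1 wc w0 wL y yl wy x xl.
pose r := Num.min (dot x e - l) (dot y e - l).
have r0 : 0 < r by rewrite lt_min !subr_gt0 xl.
have rx : r <= dot x e - l by rewrite ge_min lexx.
have ry : r <= dot y e - l by rewrite ge_min lexx orbT.
have ball_sub z a : r <= dot z e - l -> d2 a z <= r ^+ 2 -> l <= dot a e.
  move=> zr; have := cauchy_schwarz_unit (a - z) e1; rewrite dotDl dotNl => h1 h2.
  have := le_trans h1 h2; rewrite -subr_ge0 => h3.
  by rewrite leNgt; apply/negP => h4; nra.
have step z a : r <= dot z e - l -> 0 < w z -> d2 a z < r ^+ 2 -> 0 < w a.
  move=> zr wz az; apply: (positivity_on_ball C0 wc _ wz _ az) => b.
    by move=> /(ball_sub _ _ zr) /w0.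
  rewrite /= => bz; apply: wL; rewrite lt_neqAle (ball_sub _ _ zr (ltW bz)) andbT.
  apply/eqP => lb; have := cauchy_schwarz_unit (b - z) e1.
  rewrite dotDl dotNl -lb => /le_lt_trans/(_ bz); nra.
(* With [m] equal steps the squared step is [|x - y|^2 / m^2 <= |x - y|^2 / m < r^2]. *)
have [m mP] : exists m : nat, d2 x y / r ^+ 2 < m%:R.
  exists (Num.bound (d2 x y / r ^+ 2)); apply: archi_boundP.
  by rewrite divr_ge0 ?dot_ge0 ?sqr_ge0.
have r20 : 0 < r ^+ 2 by rewrite exprn_gt0.
have m0 : 0 < m%:R :> R by apply: le_lt_trans mP; rewrite divr_ge0 ?dot_ge0 ?sqr_ge0.
have m1 : 1 <= m%:R :> R by rewrite ler1n -(ltr0n R).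
pose z (k : nat) : E := y + (k%:R / m%:R) *: (x - y).
have zr k : (k <= m)%N -> r <= dot (z k) e - l.
  move=> km; rewrite /z !dotE.
  have : 0 <= k%:R / m%:R :> R by rewrite divr_ge0 // ltW.
  have : k%:R / m%:R <= 1 :> R by rewrite ler_pdivrMr // mul1r ler_nat.
  by move: (k%:R / m%:R) => t t1 t0; nra.
have zS k : d2 (z k.+1) (z k) < r ^+ 2.
  have -> : z k.+1 - z k = m%:R^-1 *: (x - y).
    apply/rowP => i; rewrite /z !mxE -natr1; field; exact: lt0r_neq0.
  rewrite dotZl dotZr; move: mP; rewrite ltr_pdivrMr //.
  set D := dot _ _ => mP.
  have -> : m%:R^-1 * (m%:R^-1 * D) = D / m%:R ^+ 2 by field; exact: lt0r_neq0.
  by rewrite ltr_pdivrMr ?exprn_gt0 //; nra.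
have wz k : (k <= m)%N -> 0 < w (z k).
  elim: k => [_|k IH km]; first by rewrite /z mul0r scale0r addr0.
  exact: (step (z k) _ (zr _ (ltnW km)) (IH (ltnW km)) (zS k)).
have := wz m (leqnn m); rewrite /z mulfV ?gt_eqF // scale1r.
by rewrite addrC subrK.
Qed.

End SolutionBounds.

(** * Moving planes *)

Section TransverseDirections.
Variables (R : realType) (n : nat).
Local Notation E := 'rV[R]_n.+1.
Local Notation d2 x y := (dot (x - y) (x - y)).
Local Notation eN := (basis_vec R (@ord_max n)).
Implicit Types (x y a e : E) (u v w : E -> R) (d l : R).

Definition transverse_sq x : R := \sum_(i | i != ord_max) x 0 i ^+ 2.

Lemma dot_transverse x : dot x x = transverse_sq x + xlast x ^+ 2.
Proof.
by rewrite /dot (bigD1 ord_max) //= addrC -expr2.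
Qed.

Lemma transverse_sq_ge0 x : 0 <= transverse_sq x.
Proof. by apply: sumr_ge0 => i _; rewrite sqr_ge0. Qed.

Lemma continuous_xlast : continuous (@xlast R n).
Proof. exact: coord_continuous. Qed.

Lemma continuous_transverse_sq : continuous transverse_sq.
Proof.
have -> : transverse_sq = (fun x => d2 x 0 - xlast x ^+ 2).
  by apply/funext => x; rewrite subr0 dot_transverse addrK.
move=> x; have c := @continuous_xlast x.
exact: (cvgB (@continuous_sqdist R n 0 x) (cvgM c c)).
Qed.

Lemma transverse_sq_shift x (s : R) : transverse_sq (x + s *: eN) = transverse_sq x.
Proof.
apply: eq_bigr => i iN; rewrite !mxE eqxx (negbTE iN) /=.
by rewrite mulr0 addr0.
Qed.

Lemma xlast_shift x (s : R) : xlast (x + s *: eN) = xlast x + s.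
Proof. by rewrite /xlast !mxE !eqxx mulr1. Qed.

Lemma dot_shift e x (s : R) : e 0 ord_max = 0 -> dot (x + s *: eN) e = dot x e.
Proof. by move=> e0; rewrite !dotE [dot eN e]dotC dot_basis e0 mulr0 addr0. Qed.

Lemma reflect_shift e l x (s : R) : e 0 ord_max = 0 ->
  reflect e l (x + s *: eN) = reflect e l x + s *: eN.
Proof. by move=> e0; rewrite /reflect dot_shift // addrAC. Qed.

Lemma dot_sqr_le_transverse e x : dot e e = 1 -> e 0 ord_max = 0 ->
  dot x e ^+ 2 <= transverse_sq x.
Proof.
move=> e1 e0; rewrite -(dot_shift x (- xlast x) e0).
apply: le_trans (cauchy_schwarz_unit _ e1) _.
by rewrite dot_transverse xlast_shift addrN expr0n addr0 transverse_sq_shift.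
Qed.

Lemma slab_bounded (r T : R) : exists M : R, forall x,
  transverse_sq x <= r -> 0 <= xlast x -> xlast x <= T -> forall i, `|x 0 i| <= M.
Proof.
have [M HM] := sqball_bounded (0 : E) (r + T ^+ 2); exists M => x xr x0 xT.
apply: HM; rewrite subr0 dot_transverse lerD // ler_sqr ?nnegrE //.
exact: le_trans xT.
Qed.

Lemma periodic_shift u (T : R) : 0 < T -> (forall x, u (x + T *: eN) = u x) ->
  forall x, exists s : R, (forall y, u (y + s *: eN) = u y) /\
    0 <= xlast (x + s *: eN) <= T.
Proof.
move=> T0 uT x.
have uTn y (k : nat) : u (y + (k%:R * T) *: eN) = u y.
  elim: k y => [|k IH] y; first by rewrite mul0r scale0r addr0.
  by rewrite -natr1 mulrDl mul1r scalerDl addrA uT IH.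
have uTz (k : int) y : u (y + (k%:~R * T) *: eN) = u y.
  case: k => k; first exact: uTn.
  have -> : (Negz k)%:~R * T = - (k.+1%:R * T) by rewrite NegzE mulrNz mulNr.
  by rewrite scaleNr -(uTn (y - _) k.+1) subrK.
pose k := Num.floor (xlast x / T).
exists ((- k)%:~R * T); split; first exact: uTz.
rewrite xlast_shift mulrNz mulNr.
have /andP[k1 k2] := real_floor_itv (num_real (xlast x / T)).
rewrite -/k in k1 k2.
move: k1 k2; rewrite ler_pdivlMr // ltr_pdivrMr // intrD mulrDl mul1r => k1 k2.
by apply/andP; split; lra.
Qed.

Lemma far_field d u : 0 < d < delta_max R -> entire_solution d u ->
  (exists2 r : R, 0 < r & forall x, ~ cylinder r x -> z2 d < u x) ->
  forall h, 0 < h -> exists r : R, forall x, r <= transverse_sq x -> z3 d - h <= u x.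
Proof.
move=> hd us [r r0 ur] h h0; have [p p0 Hp] := lower_bound_on_ball n hd h0.
(* Since [|x'|^2 <= 2 |y'|^2 + 2 |y' - x'|^2], the ball of squared radius [p] around [x] stays
   outside the cylinder. *)
exists (2 * r ^+ 2 + 2 * p) => x xr; apply: (Hp _ us) => y yx; apply: ur.
rewrite /cylinder /= /norm_x' -/(transverse_sq y); apply/negP.
rewrite -leNgt -(ger0_norm (ltW r0)) -sqrtr_sqr ler_sqrt ?transverse_sq_ge0 //.
have : transverse_sq (y - x) <= p.
  by apply: le_trans yx; rewrite dot_transverse lerDl sqr_ge0.
have : transverse_sq x <= 2 * transverse_sq y + 2 * transverse_sq (y - x).
  rewrite /transverse_sq !mulr_sumr -big_split; apply: ler_sum => i _.
  rewrite !mxE /=; move: (x 0 i) (y 0 i) => a b; have := sqr_ge0 (2 * b - a); nra.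
lra.
Qed.

End TransverseDirections.

(** * Moving planes in a fixed transverse direction *)

Section MovingPlanes.
Variables (R : realType) (n : nat).
Local Notation E := 'rV[R]_n.+1.
Local Notation eN := (basis_vec R (@ord_max n)).
Variables (d L T : R) (u : E -> R) (e : E).
Hypothesis hd : 0 < d < delta_max R.
Hypothesis us : entire_solution d u.
Hypothesis L0 : 0 < L.
Hypothesis lip : forall y a (t : R), dot a a = 1 -> `|u (y + t *: a) - u y| <= L * `|t|.
Hypothesis ub : forall x, u x < z3 d.
Hypothesis T0 : 0 < T.
Hypothesis uT : forall x, u (x + T *: eN) = u x.
Hypothesis far : forall h, 0 < h ->
  exists r : R, forall x, r <= transverse_sq x -> z3 d - h <= u x.
Hypothesis e1 : dot e e = 1.
Hypothesis e0 : e 0 ord_max = 0.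
Let s : R := (Num.sqrt 3)^-1.
Let w l x : R := u x - u (reflect e l x).
Implicit Types (x y : E) (l : R).

Let uc : continuous u. Proof. by case: us => -[]. Qed.

Let wc l : continuous (w l).
Proof.
move=> x; have cr := continuous_comp (@continuous_reflect R n e l x) (@uc _).
exact: (cvgB (@uc x) cr).
Qed.

Let w_on_plane l x : dot x e = l -> w l x = 0.
Proof. by move=> xl; rewrite /w /reflect xl subrr mulr0 scale0r subr0 subrr. Qed.

Let w_shift l x (c : R) : (forall y, u (y + c *: eN) = u y) ->
  w l (x + c *: eN) = w l x.
Proof. by move=> uc'; rewrite /w reflect_shift // !uc'. Qed.

Let w_laplacian l x : has_laplacian (w l) x
  (fdelta d (u (reflect e l x)) - fdelta d (u x)).
Proof.
have [uC ueq] := us.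
have lapE z : laplacian u z = - fdelta d (u z) by rewrite /fdelta -ueq opprK.
have -> : fdelta d (u (reflect e l x)) - fdelta d (u x) =
    laplacian u x - laplacian u (reflect e l x) by rewrite !lapE; ring.
by apply: has_laplacianB; [exact: has_laplacian_C2|exact: has_laplacian_reflect].
Qed.

Let u2 x : `|u x| <= 2. Proof. exact: solution_abs_le2 us x. Qed.

Let w_laplacian_le l x :
  `|fdelta d (u (reflect e l x)) - fdelta d (u x)| <= 11 * `|w l x|.
Proof. by rewrite /w [`|u x - _|]distrC; exact: fdelta_lipschitz. Qed.

Let far_radius : exists r : R, forall x, r <= transverse_sq x -> s < u x.
Proof.
have [_ _ /andP[b3 _]] := roots_bounds hd; rewrite -/s in b3.
have [|r Hr] := @far ((z3 d - s) / 2); first by lra.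
by exists r => x /Hr; lra.
Qed.

(* The weight [2 - exp (- 7 t)], [t] the distance to the plane, is concave, and
   concave enough near the plane to dominate the zeroth order term there;
   far away the sign of [f'] makes it unnecessary. *)
Let moving_plane_step (r l : R) : (forall x, r <= transverse_sq x -> s < u x) ->
  (forall x, transverse_sq x <= r -> l + 1 / 14 <= dot x e -> 0 <= w l x) ->
  forall x, l <= dot x e -> 0 <= w l x.
Proof.
move=> Hr core x0 x0l; rewrite leNgt; apply/negP => x0neg.
pose F (t : R) : R := 2 - expR (- 7 * (t - l)).
pose ps x := F (dot x e).
have psc : continuous ps.
  move=> x; have c1 : (fun x => - 7 * (dot x e - l)) @ x --> - 7 * (dot x e - l).
    exact: (cvgM (cvg_cst (- 7 : R)) (cvgB (@continuous_dotl R n e x) (cvg_cst l))).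
  have c2 : (fun x => expR (- 7 * (dot x e - l))) @ x --> expR (- 7 * (dot x e - l)).
    exact: (continuous_comp c1 (@continuous_expR R _)).
  exact: (cvgB (cvg_cst (2 : R)) c2).
have ps12 x : l <= dot x e -> 1 <= ps x < 2.
  move=> xl; rewrite /ps /F; have := expR_gt0 (- 7 * (dot x e - l)).
  have : expR (- 7 * (dot x e - l)) <= 1.
    by rewrite -[leRHS](@expR0 R) ler_expR; lra.
  by move=> ? ?; apply/andP; split; lra.
have ps0 x : l <= dot x e -> 0 < ps x by move=> /ps12/andP[? _]; lra.
(* The weight lies in [1, 2), so [w / ps <= - 2 h] at [x0], whereas far out [w > - h] because
   [u < z3]; the infimum is therefore reached in a bounded part. *)
pose h := - w l x0 / 4.
have h0 : 0 < h by rewrite /h; lra.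
have [r1 Hr1] := far h0.
pose r2 := `|r1| + transverse_sq x0.
have r1r2 : r1 <= r2 by apply: le_trans (ler_norm r1) _; rewrite lerDl transverse_sq_ge0.
have shift x : exists y, [/\ w l y = w l x, dot y e = dot x e,
    transverse_sq y = transverse_sq x & 0 <= xlast y <= T].
  have [c [uc' cT]] := periodic_shift T0 uT x; exists (x + c *: eN).
  by rewrite w_shift // dot_shift // transverse_sq_shift.
pose D := [set x | transverse_sq x <= r2] `&` [set x | l <= dot x e]
  `&` ([set x : E | 0 <= xlast x] `&` [set x | xlast x <= T]).
have [M HM] := slab_bounded n r2 T.
pose g x := w l x / ps x.
have [|||x [[_ xl] _]|c [[/= cr cl] [cT0 cT1]] cmin] := @min_attained R n D M g.
- have [y [_ yl yr /andP[yT0 yT1]]] := shift x0; exists y; split; split => //=.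
    by rewrite yr /r2 lerDr.
  by rewrite yl.
- apply: closedI; apply: closedI.
  + by apply: closed_fun_le; exact: continuous_transverse_sq.
  + by apply: closed_fun_ge; exact: continuous_dotl.
  + by apply: closed_fun_ge; exact: continuous_xlast.
  + by apply: closed_fun_le; exact: continuous_xlast.
- by move=> x [[xr _] [xT0 xT1]]; exact: HM.
- have px : ps x != 0 by rewrite gt_eqF // ps0.
  exact: (cvgM (@wc l x) (cvgV px (psc x))).
have gx0 : g x0 <= - (2 * h).
  have /andP[p1 p2] := ps12 _ x0l.
  by rewrite /g ler_pdivrMr ?ps0 // /h; nra.
have gc x : l <= dot x e -> g c <= g x.
  have inD x1 : l <= dot x1 e -> transverse_sq x1 <= r2 -> g c <= g x1.
    move=> x1l x1r; have [y [wy yl yr /andP[yT0 yT1]]] := shift x1.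
    have -> : g x1 = g y by rewrite /g /ps wy yl.
    by apply: cmin; split; split; rewrite //= ?yr ?yl.
  move=> xl; have [|xr] := leP (transverse_sq x) r2; first exact: inD.
  apply: le_trans (inD _ x0l _) _; first by rewrite /r2 lerDr.
  apply: le_trans gx0 _; rewrite /g ler_pdivlMr ?ps0 //.
  have /andP[p1 p2] := ps12 _ xl.
  have := Hr1 x (le_trans r1r2 (ltW xr)); have := ub (reflect e l x).
  by rewrite /w; nra.
pose mu := - g c.
have mu0 : 0 < mu by have := gc _ x0l; rewrite /mu; lra.
have wcE : w l c = - mu * ps c by rewrite /mu opprK /g divfK // gt_eqF // ps0.
have wneg : w l c < 0 by rewrite wcE mulNr oppr_lt0 mulr_gt0 // ps0.
have cl' : l < dot c e.
  rewrite lt_neqAle cl andbT; apply/eqP => lc.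
  by move: wneg; rewrite w_on_plane ?ltxx.
set X := expR (- 7 * (dot c e - l)).
have psL : has_laplacian ps c (- 49 * X).
  apply: (@has_laplacian_dot R n F (fun t => 7 * expR (- 7 * (t - l)))) => //.
    by near=> t; rewrite /F; apply: is_derive_eq; rewrite /GRing.scale /=; ring.
  by apply: is_derive_eq; rewrite /GRing.scale /= /X; ring.
have := touching (has_laplacianZ (- mu) psL) (w_laplacian l c).
have X0 : 0 < X by exact: expR_gt0.
have near_c : \forall y \near c, w l c - - mu * ps c <= w l y - - mu * ps y.
  near=> y; have yl : l <= dot y e by apply: ltW; near: y; exact: near_dot_gt.
  rewrite wcE subrr subr_ge0; have := gc _ yl.
  by rewrite /mu opprK [g y]/g ler_pdivlMr ?ps0.
move=> /(_ near_c) key.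
have key0 : 0 < - mu * (- 49 * X) by nra.
(* Only [c] has to be far out: [w < 0] puts the reflected value above [u c > s], so both values lie
   where [f] decreases. *)
have [rc|cr'] := leP r (transverse_sq c).
  have us1 := Hr _ rc.
  have us2 : u c < u (reflect e l c) by rewrite -subr_lt0.
  have := fdelta_sub d (u (reflect e l c)) (u c).
  have s2 := @inv_sqrt3_sqr R; have /andP[s3 _] := inv_sqrt3_bounds R.
  rewrite -/s in s2 s3.
  move: key key0; move: (u (reflect e l c)) (u c) us1 us2 => a b us1 us2 key key0 fE.
  have : 1 < a ^+ 2 + a * b + b ^+ 2 by nra.
  by nra.
have [cc|cc] := leP (l + 1 / 14) (dot c e).
  by have := core _ (ltW cr') cc; rewrite leNgt wneg.
(* Within 1/14 of the plane the weight contributes [49 mu X >= 49 mu / 2], more than the bound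
   [11 mu ps < 22 mu] on the reaction term. *)
have X2 : 1 / 2 <= X.
  by apply: le_trans (expR_ge1Dx _); lra.
have /andP[p1 p2] := ps12 _ cl.
have := w_laplacian_le l c; rewrite (ltr0_norm wneg) wcE => /ler_normlP[_ H].
nra.
Unshelve. all: by end_near. Qed.

Let good l := forall x, l <= dot x e -> 0 <= w l x.

(** For such [l] the core region of [moving_plane_step] is empty. *)
Let good_large : exists l0, forall l, l0 <= l -> good l.
Proof.
have [r Hr] := far_radius; exists (1 + `|r|) => l rl.
apply: (moving_plane_step Hr) => x xr xl.
have := dot_sqr_le_transverse x e1 e0; have := ler_norm r; have := normr_ge0 r.
by move: (dot x e) (transverse_sq x) xr xl => a b xr xl ? ? ?; nra.
Qed.

(** Otherwise [u 0] would dominate [u] at reflections of 0 arbitrarily far away, where [u] is close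
    to [z3]. *)
Let good_bounded_below : exists l, ~ good l.
Proof.
apply/existsNP => H; pose h := (z3 d - u 0) / 2.
have h0 : 0 < h by rewrite divr_gt0 // subr_gt0.
have [r Hr] := far h0.
pose t := 1 + `|r|.
have t1 : 1 <= t by rewrite /t lerDl.
have : 0 <= w (- t / 2) 0 by apply: H; rewrite dot0l; lra.
rewrite /w (_ : reflect e (- t / 2) 0 = - t *: e); last first.
  by rewrite /reflect dot0l; apply/rowP => i; rewrite !mxE; field.
have tE : transverse_sq (- t *: e) = t ^+ 2.
  have := dot_transverse (- t *: e); rewrite dotZl dotZr e1 /xlast mxE e0.
  by move=> E1; have := esym E1; rewrite mulr0 expr0n addr0 => ->; ring.
have : r <= transverse_sq (- t *: e).
  rewrite tE; apply: le_trans (ler_norm r) _; rewrite /t in t1 *.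
  by move: t1; move: `|r| => q; nra.
by move=> /Hr; move: h0; rewrite /h; lra.
Qed.

Let w_lipschitz l l' x : `|w l x - w l' x| <= L * (2 * `|l - l'|).
Proof.
have -> : w l x - w l' x = - (u (reflect e l x) - u (reflect e l' x)).
  by rewrite /w; ring.
have -> : reflect e l x = reflect e l' x + (2 * (l - l')) *: e.
  by apply/rowP => i; rewrite /reflect !mxE; ring.
rewrite normrN; apply: le_trans (lip _ _ e1) _.
by rewrite normrM [`|2|]ger0_norm.
Qed.

(** [l] is the extreme position down to which all planes are good. If [w l] were not identically
    zero it would be positive in the open half-space, and the planes could be pushed further. The
    second conclusion holds because projecting [x] to the final plane is reflecting it in an
    earlier, hence good, plane halfway. *)
Lemma reflection_symmetry : exists2 l,
  forall x, u (reflect e l x) = u x &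
  forall x, u (x - (dot x e - l) *: e) <= u x.
Proof.
have [l0 Hl0] := good_large; have [l1 Hl1] := good_bounded_below.
pose S := [set l | forall m, l <= m -> good m].
have Sinf : has_inf S.
  split; first by exists l0.
  exists l1 => l /= Hl; rewrite leNgt; apply/negP => ll1.
  by apply: Hl1; apply: Hl; exact: ltW.
pose l := inf S.
have good_gt m : l < m -> good m.
  move=> lm; have m0 : 0 < m - l by rewrite subr_gt0.
  have [k Sk km] := inf_adherent m0 Sinf.
  by apply: Sk; apply: ltW; move: km; rewrite addrC subrK.
have good_l : good l.
  move=> x; rewrite le_eqVlt => /predU1P[/esym/w_on_plane -> //|xl].
  rewrite leNgt; apply/negP => wneg.
  pose m := Num.min (dot x e) (l - w l x / (4 * L)).
  have L4 : 0 < 4 * L by rewrite mulr_gt0.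
  have wL : 0 < - w l x / (4 * L) by rewrite divr_gt0 // oppr_gt0.
  have lm : l < m by rewrite lt_min xl ltrDl -mulNr.
  have m1 : m <= dot x e by rewrite ge_min lexx.
  have m2 : m <= l - w l x / (4 * L) by rewrite ge_min lexx orbT.
  have := w_lipschitz m l x; rewrite [`|m - l|]gtr0_norm ?subr_gt0 //.
  have : L * (2 * (m - l)) <= - w l x / 2.
    have -> : - w l x / 2 = L * (2 * (- w l x / (4 * L))) by field; rewrite gt_eqF.
    by rewrite ler_pM2l // ler_pM2l // lerBlDl mulNr.
  have := good_gt _ lm _ m1 => h1 h2 /ler_normlP[_ h3]; lra.
have sym : forall x, l < dot x e -> w l x = 0.
  apply: contrapT => /existsNP[x1 /not_implyP[x1l /eqP x1n]].
  have x1p : 0 < w l x1 by rewrite lt_neqAle eq_sym x1n good_l // ltW.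
  have wpos x : l < dot x e -> 0 < w l x.
    move=> xl; have C0 : 0 <= 11 :> R by exact: ler0n.
    apply: (positivity_on_half_space C0 e1 (@wc l) good_l _ x1l x1p xl) => z zl.
    eexists; first exact: w_laplacian.
    have := w_laplacian_le l z; rewrite [`|w l z|]ger0_norm; last by apply: good_l; exact: ltW.
    by move=> /ler_normlP[].
  have [r Hr] := far_radius.
  (* For [th <= 1 / 28] the core of every such plane [m] is at distance at least 1/28 from the plane
     [l], where [w l] has a positive minimum by compactness; moving the plane by [th] changes [w] by
     at most [2 L th]. *)
  have [th th0 Hth] : exists2 th : R, 0 < th & forall m, l - th <= m <= l -> good m.
    pose D := [set x | transverse_sq x <= r] `&` [set x | l + 1 / 28 <= dot x e]
      `&` ([set x : E | 0 <= xlast x] `&` [set x | xlast x <= T]).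
    have shift x : transverse_sq x <= r -> l + 1 / 28 <= dot x e ->
        exists2 y, D y & w l y = w l x.
      move=> xr xl; have [c [uc' /andP[cT0 cT1]]] := periodic_shift T0 uT x.
      exists (x + c *: eN); last exact: w_shift.
      by split; split; rewrite /= ?transverse_sq_shift ?dot_shift.
    have [M HM] := slab_bounded n r T.
    have [D0|/set0P D0] := eqVneq D set0.
      exists (1 / 28) => [|m /andP[m1 m2]]; first by lra.
      apply: (moving_plane_step Hr) => x xr xl; exfalso.
      by have [||y Dy _] := shift x; [by []|lra|move: Dy; rewrite D0].
    have [|x [[xr _] [xT0 xT1]]|x _|c [[_ cl] _] cmin] := @min_attained R n D M (w l) D0.
    - apply: closedI; apply: closedI.
      + by apply: closed_fun_le; exact: continuous_transverse_sq.
      + by apply: closed_fun_ge; exact: continuous_dotl.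
      + by apply: closed_fun_ge; exact: continuous_xlast.
      + by apply: closed_fun_le; exact: continuous_xlast.
    - exact: HM.
    - exact: wc.
    have wcp : 0 < w l c by apply: wpos; move: cl => /=; lra.
    have L2 : 0 < 2 * L by rewrite mulr_gt0.
    pose th := Num.min (1 / 28) (w l c / (2 * L)).
    have th1 : th <= 1 / 28 by rewrite ge_min lexx.
    have th2 : th <= w l c / (2 * L) by rewrite ge_min lexx orbT.
    exists th => [|m /andP[m1 m2]].
      by rewrite lt_min; apply/andP; split; [lra|exact: divr_gt0].
    apply: (moving_plane_step Hr) => x xr xl.
    have [||y Dy wy] := shift x; [by []|by lra|].
    have := cmin _ Dy; rewrite wy => cx.
    have := w_lipschitz m l x; rewrite [`|m - l|]ler0_norm ?subr_le0 //.
    have : L * (2 * - (m - l)) <= w l c.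
      have -> : w l c = L * (2 * (w l c / (2 * L))) by field; rewrite gt_eqF.
      by rewrite ler_pM2l // ler_pM2l //; lra.
    by move=> h1 /ler_normlP[h2 _]; lra.
  have : S (l - th).
    move=> m lm; have [ml|ml] := leP m l; last exact: good_gt.
    by apply: Hth; rewrite lm.
  by move=> /(inf_lbound Sinf.2); rewrite -/l; lra.
have sym' x : u (reflect e l x) = u x.
  have [xl|xl|xl] := ltgtP l (dot x e).
  - by apply/esym/eqP; rewrite -subr_eq0; apply/eqP; exact: sym.
  - have := sym (reflect e l x); rewrite dot_reflect // /w reflectK // => H.
    by apply/eqP; rewrite -subr_eq0; apply/eqP; apply: H; lra.
  - by rewrite /reflect -xl subrr mulr0 scale0r subr0.
exists l => //.
have proj x : l <= dot x e -> u (x - (dot x e - l) *: e) <= u x.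
  move=> xl; pose m := (dot x e + l) / 2.
  have gm : good m.
    have [lm|lm|lm] := ltgtP l m; [exact: good_gt|by move: lm; rewrite /m; lra|].
    by rewrite -lm.
  have : 0 <= w m x by apply: gm; rewrite /m; lra.
  rewrite /w /reflect (_ : 2 * (dot x e - m) = dot x e - l); last by rewrite /m; field.
  by rewrite subr_ge0.
move=> x; have [xl|xl] := leP l (dot x e); first exact: proj.
have := proj (reflect e l x); rewrite sym' dot_reflect // => H.
have -> : x - (dot x e - l) *: e =
    reflect e l x - (2 * l - dot x e - l) *: e.
  by apply/rowP => i; rewrite /reflect !mxE; ring.
by apply: H; lra.
Qed.

End MovingPlanes.

(** * Axial symmetry *)

Section AxialSymmetry.
Variables (R : realType) (n : nat).
Local Notation E := 'rV[R]_n.+1.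
Local Notation eN := (basis_vec R (@ord_max n)).
Local Notation e_ := (basis_vec R).
Variables (b : R) (u : E -> R).
Hypothesis ub : forall x, u x < b.
Hypothesis far : forall h, 0 < h ->
  exists r : R, forall x, r <= transverse_sq x -> b - h <= u x.
Hypothesis refl_sym : forall e, dot e e = 1 -> e 0 ord_max = 0 ->
  exists2 l, forall x, u (reflect e l x) = u x &
             forall x, u (x - (dot x e - l) *: e) <= u x.
Implicit Types (x y z e : E) (r : seq 'I_n.+1).

Let dot_basis_self (i : 'I_n.+1) : dot (e_ i) (e_ i) = 1.
Proof. by rewrite dot_basis mxE !eqxx. Qed.

Let basis_last (i : 'I_n.+1) : i != ord_max -> e_ i 0 ord_max = 0.
Proof. by move=> iN; rewrite mxE eq_sym (negbTE iN) andbF. Qed.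

Let center_coords : exists a : E, forall i : 'I_n.+1, i != ord_max ->
  (forall y, u (a + (y - (2 * y 0 i) *: e_ i)) = u (a + y)) /\
  (forall y, u (a + (y - y 0 i *: e_ i)) <= u (a + y)).
Proof.
have /choice[l Hl] (i : 'I_n.+1) : exists l : R, i != ord_max ->
    (forall x, u (reflect (e_ i) l x) = u x) /\
    (forall x, u (x - (dot x (e_ i) - l) *: e_ i) <= u x).
  have [->|iN] := eqVneq i ord_max; first by exists 0.
  by have [l Hl1 Hl2] := refl_sym (dot_basis_self i) (basis_last iN); exists l.
exists (\row_i l i) => i iN; have [H1 H2] := Hl i iN; split=> y.
  rewrite -[RHS]H1; congr u; rewrite /reflect dot_basis.
  by apply/rowP => j; rewrite !mxE; ring.
apply: le_trans (H2 _); rewrite dot_basis.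
rewrite (_ : _ + (y - _) = \row_i l i + y - ((\row_i l i + y) 0 i - l i) *: e_ i) //.
by apply/rowP => j; rewrite !mxE; ring.
Qed.

(** The point reflection [x' -> - x'], product of all transverse coordinate reflections. *)
Definition flip x : E := \row_j (if j == ord_max then x 0 j else - x 0 j).

Let flip_sym a : (forall i : 'I_n.+1, i != ord_max ->
    forall y, u (a + (y - (2 * y 0 i) *: e_ i)) = u (a + y)) ->
  forall x, u (a + flip x) = u (a + x).
Proof.
move=> Ha x.
pose p r : E := \row_j (if j \in r then - x 0 j else x 0 j).
have step r : uniq r -> ord_max \notin r -> u (a + p r) = u (a + x).
  elim: r => [_ _|i r IH /= /andP[ir ur]].
    by congr (u (a + _)); apply/rowP => j; rewrite mxE.
  rewrite inE negb_or eq_sym => /andP[iN Nr]; rewrite -(IH ur Nr) -[RHS](Ha i iN).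
  congr (u (a + _)); apply/rowP => j; rewrite !mxE !eqxx inE (negbTE ir) /=.
  have [->|ji] := eqVneq j i; last by rewrite mulr0 subr0.
  by rewrite (negbTE ir) /=; ring.
have -> : flip x = p [seq j <- enum 'I_n.+1 | j != ord_max].
  by apply/rowP => j; rewrite !mxE mem_filter mem_enum andbT; case: eqP.
apply: step; first by rewrite filter_uniq ?enum_uniq.
by rewrite mem_filter eqxx.
Qed.

Let axis_min a : (forall i : 'I_n.+1, i != ord_max ->
    forall y, u (a + (y - y 0 i *: e_ i)) <= u (a + y)) ->
  forall x, u (a + xlast x *: eN) <= u (a + x).
Proof.
move=> Ha x.
pose p r : E := \row_j (if j \in r then 0 else x 0 j).
have step r : uniq r -> ord_max \notin r -> u (a + p r) <= u (a + x).
  elim: r => [_ _|i r IH /= /andP[ir ur]].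
    by rewrite (_ : p [::] = x) //; apply/rowP => j; rewrite mxE.
  rewrite inE negb_or eq_sym => /andP[iN Nr].
  apply: le_trans (IH ur Nr); apply: le_trans (Ha i iN _).
  rewrite (_ : p (i :: r) = p r - p r 0 i *: e_ i) //.
  apply/rowP => j; rewrite !mxE !eqxx inE (negbTE ir) /=.
  have [->|ji] := eqVneq j i; last by rewrite mulr0 subr0.
  by rewrite (negbTE ir) /=; ring.
have -> : xlast x *: eN = p [seq j <- enum 'I_n.+1 | j != ord_max].
  apply/rowP => j; rewrite !mxE mem_filter mem_enum andbT eqxx /=.
  by have [->|jN] := eqVneq j ord_max; [rewrite mulr1|rewrite mulr0].
apply: step; first by rewrite filter_uniq ?enum_uniq.
by rewrite mem_filter eqxx.
Qed.

(* The product of two parallel reflections is a translation, which decay forbids. *)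
Let planes_meet a e l : (forall x, u (a + flip x) = u (a + x)) ->
  dot e e = 1 -> e 0 ord_max = 0 ->
  (forall x, u (reflect e l x) = u x) -> l = dot a e.
Proof.
move=> Ha e1 e0 He; apply: contrapT => lne.
pose c := l - dot a e; have c0 : c != 0 by rewrite subr_eq0; apply/eqP.
have He' y : u (a + (y - (2 * (dot y e - c)) *: e)) = u (a + y).
  rewrite -[RHS]He; congr u; rewrite /reflect /c dotDl.
  by apply/rowP => j; rewrite !mxE; ring.
have dflip y : dot (flip y) e = - dot y e.
  rewrite /dot -sumrN; apply: eq_bigr => j _; rewrite mxE.
  by case: eqP => [->|_]; [rewrite e0 !mulr0 oppr0|rewrite mulNr].
have flipD y (k : R) : flip (flip y + k *: e) = y - k *: e.
  apply/rowP => j; rewrite !mxE.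
  by case: eqP => [->|_]; [rewrite e0 mulr0 oppr0|ring].
(* Conjugating the reflection at offset [c] by [flip] gives the one at offset [- c]; the planes are
   [2 c] apart, so their product translates by [4 c]. *)
have trans y : u (a + (y + (4 * c) *: e)) = u (a + y).
  pose z := y + (2 * c) *: e; pose y0 := z - (2 * dot z e) *: e.
  have d0 : dot y0 e = - dot z e by rewrite /y0 !dotE e1; ring.
  rewrite (_ : y + (4 * c) *: e = y0 - (2 * (dot y0 e - c)) *: e); last first.
    by rewrite d0 /y0 /z; apply/rowP => j; rewrite !mxE; ring.
  rewrite He' -Ha -(He' (flip y0)) dflip.
  rewrite (_ : flip y0 - _ = flip y0 + (2 * (dot y0 e + c)) *: e); last first.
    by apply/rowP => j; rewrite !mxE; ring.
  rewrite -Ha flipD d0 /y0 /z; congr (u (a + _)).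
  by apply/rowP => j; rewrite !mxE; ring.
have transn (k : nat) : u (a + (k%:R * (4 * c)) *: e) = u a.
  elim: k => [|k IH]; first by rewrite mul0r scale0r addr0.
  by rewrite -[RHS]IH -[RHS]trans -natr1 mulrDl mul1r scalerDl.
have h0 : 0 < (b - u a) / 2 by rewrite divr_gt0 // subr_gt0.
have [r Hr] := far h0.
pose q := (`|r| + 1 + `|dot a e|) / `|4 * c|.
have c4 : 0 < `|4 * c| by rewrite normr_gt0 mulf_neq0.
have q0 : 0 <= q by rewrite divr_ge0 // ?(ltW c4) // addr_ge0 // addr_ge0.
have := archi_boundP q0; set k := Num.bound q => qk.
have : r <= transverse_sq (a + (k%:R * (4 * c)) *: e).
  apply: le_trans (dot_sqr_le_transverse _ e1 e0).
  rewrite !dotE e1 mulr1.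
  have : `|r| + 1 + `|dot a e| <= `|k%:R * (4 * c)|.
    by rewrite normrM [`|k%:R|]ger0_norm // -ler_pdivrMr // ltW.
  move: (k%:R * (4 * c)) (dot a e) => A B AB.
  have : `|A| <= `|B + A| + `|B|.
    rewrite -[X in `|X| <= _](addKr B) addrC; apply: le_trans (ler_normD _ _) _.
    by rewrite normrN addrC.
  move=> AB2; have AB3 : `|r| + 1 <= `|B + A| by lra.
  rewrite -[(B + A) ^+ 2]real_normK ?num_real //.
  apply: le_trans (ler_norm r) _; have := normr_ge0 r.
  by move: `|r| `|B + A| AB3 => r' C ? ?; nra.
by move=> /Hr; rewrite transn; move: (ub a); lra.
Qed.

(** If [x] and [y] have the same [|x'|] and the same last coordinate, the hyperplane bisecting them
    passes through the origin and its normal [x - y] is transverse. By [planes_meet] its translate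
    through [a] is the symmetry plane of that direction. *)
Lemma axial_symmetry : exists2 a : E,
  forall x y, transverse_sq x = transverse_sq y -> xlast x = xlast y ->
    u (a + x) = u (a + y) &
  forall x, u (a + xlast x *: eN) <= u (a + x).
Proof.
have [a Ha] := center_coords.
have Hflip := flip_sym (fun i iN => (Ha i iN).1).
exists a; last exact: axis_min (fun i iN => (Ha i iN).2).
move=> x y xy xyN.
have [->//|nxy] := eqVneq x y.
pose z := x - y; pose q := Num.sqrt (dot z z).
have zz : 0 < dot z z.
  rewrite lt_neqAle dot_ge0 andbT eq_sym; apply/eqP => /dot_eq0/eqP.
  by rewrite subr_eq0 (negbTE nxy).
have q0 : 0 < q by rewrite sqrtr_gt0.
have qq : q ^+ 2 = dot z z by rewrite sqr_sqrtr // ltW.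
pose e := q^-1 *: z.
have e1 : dot e e = 1.
  by rewrite /e dotZl dotZr -qq; field; rewrite gt_eqF.
have e0 : e 0 ord_max = 0.
  by rewrite !mxE; move: xyN; rewrite /xlast => ->; rewrite subrr mulr0.
have [l Hl _] := refl_sym e1 e0.
have lE := planes_meet Hflip e1 e0 Hl.
rewrite -(Hl (a + x)); congr u; rewrite /reflect lE dotDl [dot a e + _]addrC addrK.
have xz : 2 * dot x z = dot z z.
  have xx : dot x x = dot y y by rewrite !dot_transverse xy xyN.
  by rewrite /z !dotE xx [dot y x]dotC; ring.
rewrite /e dotZr scalerA (_ : 2 * (q^-1 * dot x z) * q^-1 = 1).
  by rewrite scale1r /z -addrA opprB [x + _]addrC subrK.
have -> : 2 * (q^-1 * dot x z) * q^-1 = 2 * dot x z / q ^+ 2.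
  by field; rewrite gt_eqF.
by rewrite xz -qq divff // gt_eqF // exprn_gt0.
Qed.

End AxialSymmetry.

(** * The sliding subsolution *)

Section Bump.
Variables (R : realType) (n : nat) (b d : R).
Local Notation E := 'rV[R]_n.+1.
Local Notation N := (n.+1%:R : R).
Hypothesis hb : 0 < b <= 1 / 10.
Hypothesis hdb : 0 < d < b ^+ 2 / 32.
Implicit Types (s v t : R) (z : E).

(* With [T = tanh (s / sqrt 2)] the heteroclinic and [v = 1 / (1 + T)], the
   profile is [T + b^2 p], [p = - T / (1 + T)]: the operator linearised at [T]
   sends [p] to [1 - 3 T + 3 T^2 > 0]. *)
Definition profile_var s : R := (1 + expR (- Num.sqrt 2 * s)) / 2.
Definition profile_of v : R := v^-1 - 1 - b ^+ 2 * (1 - v).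
(** Derivatives in [s], expressed in [v] through [v' = - (sqrt 2 / 2) (2 v - 1)]. *)
Definition profile_d1 v : R := Num.sqrt 2 / 2 * ((2 * v - 1) * (v ^- 2 - b ^+ 2)).
Definition profile_d2 v : R := (2 * v - 1) * (v ^- 2 - v ^- 3 + b ^+ 2).

Let b0 : 0 < b. Proof. by case/andP: hb. Qed.

Let k2 : (Num.sqrt 2 : R) ^+ 2 = 2. Proof. by rewrite sqr_sqrtr. Qed.
Let k0 : 0 < Num.sqrt 2 :> R. Proof. by rewrite sqrtr_gt0. Qed.
Let k1 : 1 <= (Num.sqrt 2 : R) <= 2.
Proof. by move: k2 k0 => ? ?; apply/andP; split; nra. Qed.

Lemma profile_var_gt s : 1 / 2 < profile_var s.
Proof. by have := expR_gt0 (- Num.sqrt 2 * s); rewrite /profile_var; lra. Qed.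

Lemma is_derive_profile_var s :
  is_derive s (1 : R) profile_var (- (Num.sqrt 2 / 2) * (2 * profile_var s - 1)).
Proof.
rewrite /profile_var; apply: is_derive_eq.
by rewrite /GRing.scale /=; field.
Qed.

Lemma is_derive_inv_pow m v : v != 0 ->
  is_derive v (1 : R) (fun v => v ^- m) (- m%:R * v ^- m.+1).
Proof.
move=> v0.
have dm : is_derive v (1 : R) (fun v : R => v ^+ m) (m%:R * v ^+ m.-1).
  by split; [exact: exprn_derivable|rewrite exp_derive /GRing.scale /= mulr1].
rewrite (_ : - _ * _ = - (v ^+ m) ^- 2 *: (m%:R * v ^+ m.-1)).
  by apply: (@is_deriveV R (fun v => v ^+ m) v _ 1); rewrite expf_neq0.
rewrite /GRing.scale /=; case: m {dm} => [|m] /=; first by rewrite !mul0r oppr0 !mul0r mulr0.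
have vm : v ^+ m != 0 by rewrite expf_neq0.
by rewrite !exprS; field; rewrite v0 vm.
Qed.

Lemma is_derive_profile s : is_derive s (1 : R) (fun s => profile_of (profile_var s))
  (profile_d1 (profile_var s)).
Proof.
have v0 : profile_var s != 0 by rewrite gt_eqF //; have := profile_var_gt s; lra.
have ? : is_derive (profile_var s) (1 : R) (fun v : R => v^-1) (- 1 * profile_var s ^- 2).
  exact: (@is_derive_inv_pow 1).
have D : is_derive (profile_var s) (1 : R) profile_of (- profile_var s ^- 2 + b ^+ 2).
  by apply: is_derive_eq; rewrite /GRing.scale /=; ring.
rewrite (_ : profile_d1 _ = (- profile_var s ^- 2 + b ^+ 2) *
  (- (Num.sqrt 2 / 2) * (2 * profile_var s - 1))); last by rewrite /profile_d1; ring.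
exact: (@is_derive1_comp _ profile_of profile_var s _ _ D (is_derive_profile_var s)).
Qed.

Lemma is_derive_profile_d1 s :
  is_derive s (1 : R) (fun s => profile_d1 (profile_var s)) (profile_d2 (profile_var s)).
Proof.
have v0 : profile_var s != 0 by rewrite gt_eqF //; have := profile_var_gt s; lra.
set v := profile_var s in v0 *.
have ? : is_derive v (1 : R) (fun v : R => v ^- 2) (- 2 * v ^- 3).
  exact: (@is_derive_inv_pow 2).
have D : is_derive v (1 : R) profile_d1
    (Num.sqrt 2 / 2 * (2 * (v ^- 2 - b ^+ 2) + (2 * v - 1) * (- 2 * v ^- 3))).
  by apply: is_derive_eq; rewrite /GRing.scale /=; field.
rewrite (_ : profile_d2 _ = (Num.sqrt 2 / 2 * (2 * (v ^- 2 - b ^+ 2)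
    + (2 * v - 1) * (- 2 * v ^- 3))) * (- (Num.sqrt 2 / 2) * (2 * v - 1))).
  exact: (@is_derive1_comp _ profile_d1 profile_var s _ _ D (is_derive_profile_var s)).
rewrite (_ : _ * (- (Num.sqrt 2 / 2) * (2 * v - 1)) = - ((Num.sqrt 2) ^+ 2 / 4 *
  (2 * v - 1) * (2 * (v ^- 2 - b ^+ 2) + (2 * v - 1) * (- 2 * v ^- 3)))).
  by rewrite k2 /profile_d2; field.
by field.
Qed.

(** The linear term [1 - 3 t + 3 t^2] is at least 1/4. The remainder comes from the cubic: for
    [v <= 1] it is small because [p^2 <= 1 / 4], and for [v > 1] its quadratic part has the good
    sign while [b p <= 1] controls the rest. *)
Lemma profile_subsolution v : 1 / 2 < v -> v <= b^-1 ->
  b ^+ 2 / 8 <= profile_d2 v + (profile_of v - profile_of v ^+ 3).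
Proof.
move=> v2 vb; have v0 : v != 0 by rewrite gt_eqF //; lra.
have [b_gt0 b1] : 0 < b /\ b <= 1 / 10 by case/andP: hb.
have bv : b * v <= 1 by rewrite -(mulfV (lt0r_neq0 b0)) ler_pM2l.
pose t := v^-1 - 1; pose p := v - 1.
have -> : profile_d2 v + (profile_of v - profile_of v ^+ 3) =
    b ^+ 2 * (1 - 3 * t + 3 * t ^+ 2) - 3 * t * (b ^+ 2) ^+ 2 * p ^+ 2
    - (b ^+ 2) ^+ 3 * p ^+ 3.
  by rewrite /profile_d2 /profile_of /t /p; field.
have B0 : 0 < b ^+ 2 by rewrite exprn_gt0.
have B1 : b ^+ 2 <= 1 / 100 by nra.
have [v1|v1] := leP v 1.
  have t0 : 0 <= t by rewrite /t subr_ge0 invf_ge1 //; lra.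
  have t1 : t <= 1.
    have : v^-1 <= (1 / 2)^-1 by rewrite lef_pV2 ?posrE //; lra.
    by rewrite div1r invrK /t; lra.
  have p3 : p ^+ 3 <= 0 by rewrite exprS /p mulr_le0_ge0 ?sqr_ge0 //; lra.
  have p2 : p ^+ 2 <= 1 / 4 by rewrite /p; nra.
  have B3 : 0 <= - ((b ^+ 2) ^+ 3 * p ^+ 3) by rewrite -mulrN mulr_ge0 // ?exprn_ge0 ?(ltW b0); lra.
  have tp : t * p ^+ 2 <= 1 / 4 by have := sqr_ge0 p; nra.
  have : 3 * t * (b ^+ 2) ^+ 2 * p ^+ 2 <= b ^+ 2 / 100.
    rewrite (_ : _ * p ^+ 2 = b ^+ 2 * (b ^+ 2 * (3 * (t * p ^+ 2)))); last by ring.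
    by rewrite ler_pM2l //; nra.
  have : b ^+ 2 / 4 <= b ^+ 2 * (1 - 3 * t + 3 * t ^+ 2).
    by rewrite ler_pM2l //; have := sqr_ge0 (2 * t - 1); lra.
  lra.
have t0 : t <= 0 by rewrite /t subr_le0 invf_le1 //; lra.
have p0 : 0 <= p by rewrite /p; lra.
have bp : b * p <= 1 by rewrite /p; lra.
have B3 : (b ^+ 2) ^+ 3 * p ^+ 3 <= b ^+ 2 * b.
  rewrite (_ : _ * p ^+ 3 = (b ^+ 2 * b) * (b * p) ^+ 3); last by ring.
  by rewrite ler_piMr ?mulr_ge0 ?(ltW B0) ?(ltW b0) // exprn_ile1 // mulr_ge0 // ltW.
have : 0 <= - (3 * t * (b ^+ 2) ^+ 2 * p ^+ 2).
  rewrite (_ : - _ = 3 * (- t) * ((b ^+ 2) ^+ 2 * p ^+ 2)); last by ring.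
  by apply: mulr_ge0; [apply: mulr_ge0; lra|rewrite mulr_ge0 ?sqr_ge0].
have : b ^+ 2 <= b ^+ 2 * (1 - 3 * t + 3 * t ^+ 2).
  by rewrite ler_peMr ?(ltW B0) //; have := sqr_ge0 t; lra.
nra.
Qed.

Lemma profile_d1_le1 v : 1 / 2 < v -> profile_d1 v <= 1.
Proof.
move=> v2; have v0 : 0 < v by lra.
have : (2 * v - 1) * (v ^- 2 - b ^+ 2) <= 1.
  apply: (@le_trans _ _ ((2 * v - 1) * v ^- 2)).
    by rewrite ler_wpM2l //; [lra|have := sqr_ge0 b; lra].
  by rewrite ler_pdivrMr ?exprn_gt0 //; have := sqr_ge0 (v - 1); lra.
have /andP[h1 h2] := k1; rewrite /profile_d1; move: (_ * (_ - _)) => a a1.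
have [a0|a0] := leP 0 a; nra.
Qed.

(** For a profile [h] in [s = (ro^2 - |z|^2) / (2 ro)] the Laplacian is
    [h'' - (2 s h'' + N h') / ro]; this controls the first error term. *)
Lemma profile_d2_moment s : profile_var s <= b^-1 -> s * profile_d2 (profile_var s) <= 2.
Proof.
move=> vb; set v := profile_var s in vb *.
have v2 : 1 / 2 < v := profile_var_gt s; have v0 : 0 < v by lra.
have X0 := expR_gt0 (- Num.sqrt 2 * s).
have XE : 2 * v - 1 = expR (- Num.sqrt 2 * s) by rewrite /v /profile_var; field.
have [b_gt0 b1] : 0 < b /\ b <= 1 / 10 by case/andP: hb.
have B1 : b ^+ 2 <= 1 / 100 by nra.
have hv : v ^- 2 - v ^- 3 = v ^- 3 * (v - 1) by field; rewrite gt_eqF.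
have v3 : 0 < v ^- 3 by rewrite invr_gt0 exprn_gt0.
have [s0|s0] := leP 0 s.
  have v1 : v <= 1.
    have : expR (- Num.sqrt 2 * s) <= 1.
      by rewrite -[leRHS](@expR0 R) ler_expR mulNr oppr_le0 mulr_ge0 // ltW.
    by lra.
  have d2 : profile_d2 v <= expR (- Num.sqrt 2 * s).
    rewrite /profile_d2 XE hv -[leRHS]mulr1 ler_pM2l //.
    have : v ^- 3 * (v - 1) <= 0 by rewrite mulr_ge0_le0 ?(ltW v3) //; lra.
    lra.
  apply: le_trans (ler_wpM2l s0 d2) _.
  rewrite mulNr expRN ler_pdivrMr ?expR_gt0 //.
  have := expR_ge1Dx (Num.sqrt 2 * s); have /andP[? _] := k1; nra.
have v1 : 1 <= v.
  have : 1 <= expR (- Num.sqrt 2 * s).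
    by rewrite -[leLHS](@expR0 R) ler_expR mulNr oppr_ge0 mulr_ge0_le0 // ltW.
  by lra.
apply: (@le_trans _ _ 0) => //; rewrite mulr_le0_ge0 ?(ltW s0) //.
rewrite /profile_d2 XE mulr_ge0 ?(ltW X0) // hv.
have : 0 <= v ^- 3 * (v - 1) by rewrite mulr_ge0 ?(ltW v3) //; lra.
have := sqr_ge0 b; lra.
Qed.

(** The variable [(ro^2 - |z|^2) / (2 ro)] imitates the distance to the sphere of radius [ro] but is
    smooth at the centre. The bound [1 - b^2 / 2] is the limit of the profile at infinity. *)
Lemma compactly_supported_subsolution : exists2 p : R, 0 < p & exists phi : E -> R,
  [/\ continuous phi, 3 / 5 < phi 0,
   forall z, dot z z <= p -> phi z < 1 - b ^+ 2 / 2,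
   forall z, dot z z = p -> phi z <= - 1 + 2 * b &
   forall z, dot z z < p -> exists2 L, has_laplacian phi z L & - fdelta d (phi z) < L].
Proof.
have [b_gt0 b1] : 0 < b /\ b <= 1 / 10 by case/andP: hb.
have B0 : 0 < b ^+ 2 by rewrite exprn_gt0.
have B1 : b ^+ 2 <= 1 / 100 by nra.
have N1 : 1 <= N by rewrite ler1n.
(* The curvature error is at most [(4 + N) / ro = b^2 / 32]; with [d < b^2 / 32] this spends only
   half of the margin [b^2 / 8]. *)
pose ro : R := 32 * (4 + N) / b ^+ 2.
have roE : (4 + N) / ro = b ^+ 2 / 32.
  by rewrite /ro; field; rewrite gt_eqF //= gt_eqF //; lra.
have ro_big : 320 <= ro by rewrite /ro ler_pdivlMr //; nra.
have ro0 : 0 < ro by lra.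
have bV : 10 <= b^-1 by rewrite -[leLHS]invrK lef_pV2 ?posrE //; lra.
(* Solves [profile_var s0 = 1 / b], where the profile equals [- 1 + 2 b - b^2]; the sphere
   [|z|^2 = p] is where [s = s0]. *)
pose s0 : R := - (ln (2 * b^-1 - 1) / Num.sqrt 2).
have s0E : profile_var s0 = b^-1.
  have -> : profile_var s0 = (1 + expR (ln (2 * b^-1 - 1))) / 2.
    by rewrite /profile_var /s0; congr ((1 + expR _) / 2); field; rewrite gt_eqF.
  rewrite lnK ?posrE; last by lra.
  by field; rewrite gt_eqF.
have s0neg : s0 < 0.
  by rewrite oppr_lt0 divr_gt0 // ln_gt0 //; lra.
pose p := ro ^+ 2 - 2 * ro * s0.
have p0 : 0 < p by rewrite /p; nra.
pose q z := ro ^+ 2 - dot (z - 0) (z - 0).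
pose phi z := profile_of (profile_var (q z / (2 * ro))).
have var_mono s t : s <= t -> profile_var t <= profile_var s.
  move=> st; rewrite /profile_var ler_pM2r ?invr_gt0 // lerD2l ler_expR !mulNr lerN2.
  by rewrite ler_pM2l.
have dom z : dot z z <= p -> profile_var (q z / (2 * ro)) <= b^-1.
  move=> zp; rewrite -s0E; apply: var_mono; have ro2 : 0 < 2 * ro by lra.
  by rewrite ler_pdivlMr // /q subr0; move: zp; rewrite /p; lra.
have vgt z : 1 / 2 < profile_var (q z / (2 * ro)) by exact: profile_var_gt.
have phic : continuous phi.
  move=> z.
  have c1 : (fun z => q z / (2 * ro)) @ z --> q z / (2 * ro).
    exact: (cvgM (cvgB (cvg_cst (ro ^+ 2)) (@continuous_sqdist R n 0 z)) (cvg_cst (2 * ro)^-1)).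
  have c2 : {for q z / (2 * ro), continuous (fun s => profile_of (profile_var s))}.
    apply/differentiable_continuous/derivable1_diffP.
    by case: (is_derive_profile (q z / (2 * ro))).
  exact: (continuous_comp c1 c2).
exists p => //; exists phi; split => //.
- have -> : phi 0 = profile_of (profile_var (ro / 2)).
    by rewrite /phi /q subr0 dot0l subr0; congr (profile_of (profile_var _)); field; rewrite gt_eqF.
  have X0 := expR_gt0 (- Num.sqrt 2 * (ro / 2)).
  have X1 : expR (- Num.sqrt 2 * (ro / 2)) <= 1 / 100.
    rewrite mulNr expRN div1r lef_pV2 ?posrE ?expR_gt0 //.
    have := expR_ge1Dx (Num.sqrt 2 * (ro / 2)); have /andP[? _] := k1; nra.
  set v := profile_var _; have v1 : v <= 101 / 200 by rewrite /v /profile_var; lra.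
  have v2 : 1 / 2 < v by rewrite /v /profile_var; lra.
  have : 200 / 101 <= v^-1 by rewrite -[leLHS]invrK lef_pV2 ?posrE //; lra.
  have : b ^+ 2 * (1 - v) <= b ^+ 2 by rewrite ler_piMr ?(ltW B0) //; lra.
  rewrite /profile_of; lra.
- move=> z /dom; have := vgt z; rewrite /phi.
  move: (profile_var _) => v v2 vb; have v0 : 0 < v by lra.
  have bv : b * v <= 1 by rewrite -(mulfV (lt0r_neq0 b0)) ler_pM2l.
  rewrite -subr_gt0 (_ : _ - _ = (2 * v - 1) * (2 - b ^+ 2 * v) / (2 * v)).
    have : b * (b * v) <= b * 1 by rewrite ler_pM2l.
    by move=> h; apply: divr_gt0; [apply: mulr_gt0|]; lra.
  by rewrite /profile_of; field; rewrite gt_eqF.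
- move=> z zp.
  have -> : phi z = profile_of (profile_var s0).
    rewrite /phi /q subr0 zp /p; congr (profile_of (profile_var _)).
    by field; rewrite gt_eqF.
  rewrite s0E /profile_of invrK (_ : b ^+ 2 * (1 - b^-1) = b ^+ 2 - b).
    by lra.
  by field; rewrite gt_eqF.
- move=> z zp; set s := q z / (2 * ro).
  have vb := dom z (ltW zp); rewrite -/s in vb.
  pose F t := profile_of (profile_var (t / (2 * ro))).
  pose F' t := (2 * ro)^-1 * profile_d1 (profile_var (t / (2 * ro))).
  have dl t : is_derive t (1 : R) (fun t => t / (2 * ro)) (2 * ro)^-1.
    by apply: is_derive_eq; rewrite /GRing.scale /=; ring.
  have dF t : is_derive t (1 : R) F (F' t).
    rewrite /F' mulrC.
    exact: (@is_derive1_comp _ (fun s => profile_of (profile_var s)) (fun t => t / (2 * ro))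
      t _ _ (is_derive_profile _) (dl t)).
  have dF' t : is_derive t (1 : R) F'
      ((2 * ro)^-1 * (profile_d2 (profile_var (t / (2 * ro))) * (2 * ro)^-1)).
    have D := @is_derive1_comp _ (fun s => profile_d1 (profile_var s)) (fun t => t / (2 * ro))
      t _ _ (is_derive_profile_d1 _) (dl t).
    exact: (is_deriveZ (2 * ro)^-1 D).
  eexists.
    apply: (@has_laplacian_sqdist R n F F' _ (ro ^+ 2) 0 z) => //.
    by near=> t; exact: dF.
  rewrite -/(q z) /F' -/s -/(phi z).
  have -> : dot (z - 0) (z - 0) = ro ^+ 2 - 2 * ro * s.
    by rewrite /s /q; field; rewrite gt_eqF.
  have key := profile_subsolution (profile_var_gt s) vb.
  have m := profile_d2_moment vb; have d1 := profile_d1_le1 (profile_var_gt s).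
  have phiE : phi z = profile_of (profile_var s) by [].
  rewrite phiE; move: key m d1; move: (profile_of _) (profile_d1 _) (profile_d2 _).
  move=> h0 h1 h2 key m d1.
  rewrite (_ : _ - _ = h2 - (2 * (s * h2) + N * h1) / ro); last first.
    by field; rewrite gt_eqF.
  have : (2 * (s * h2) + N * h1) / ro <= (4 + N) / ro.
    rewrite ler_pM2r ?invr_gt0 // lerD //; first lra.
    by rewrite ler_piMr // ler0n.
  rewrite roE /fdelta; case/andP: hdb => ? ? ?; lra.
Unshelve. all: by end_near. Qed.

End Bump.

(** * Sliding, and propagation of smallness *)

Section SmallParameter.
Variables (R : realType) (n : nat).
Local Notation E := 'rV[R]_n.+1.
Local Notation d2 x y := (dot (x - y) (x - y)).
Local Notation eN := (basis_vec R (@ord_max n)).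
Implicit Types (x y z a e : E) (u : E -> R) (d : R).

Lemma has_laplacian_shift f a x (L : R) : has_laplacian f (x - a) L ->
  has_laplacian (fun z => f (z - a)) x L.
Proof.
move=> [c hc cL]; exists c => // i; have := hc i.
by under eq_fun do rewrite addrAC.
Qed.

Lemma lipschitz_sqdist u (L : R) :
  (forall y e (t : R), dot e e = 1 -> `|u (y + t *: e) - u y| <= L * `|t|) ->
  forall x y, `|u x - u y| <= L * Num.sqrt (d2 x y).
Proof.
move=> lip x y; have [->|xy] := eqVneq x y.
  by rewrite !subrr dot0l sqrtr0 mulr0 normr0.
have zz : 0 < d2 x y.
  rewrite lt_neqAle dot_ge0 andbT eq_sym; apply/eqP => /dot_eq0/eqP.
  by rewrite subr_eq0 (negbTE xy).
set q := Num.sqrt _; have q0 : 0 < q by rewrite sqrtr_gt0.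
have qq : q ^+ 2 = d2 x y by rewrite sqr_sqrtr // ltW.
have e1 : dot (q^-1 *: (x - y)) (q^-1 *: (x - y)) = 1.
  by rewrite dotZl dotZr -qq; field; rewrite gt_eqF.
have := lip y _ q e1; rewrite (gtr0_norm q0) scalerA mulfV ?gt_eqF // scale1r.
by rewrite [y + _]addrC subrK.
Qed.

(** A solution above [z2] everywhere would be pushed up to [z3] by arbitrarily large balls. *)
Lemma exists_le_z2 d u : 0 < d < delta_max R -> entire_solution d u ->
  (forall x, u x < z3 d) -> exists x, u x <= z2 d.
Proof.
move=> hd us ub; apply: contrapT => H.
have H' x : z2 d < u x by rewrite ltNge; apply/negP => ux; apply: H; exists x.
have h0 : 0 < (z3 d - u 0) / 2 by rewrite divr_gt0 // subr_gt0.
have [p _ Hp] := lower_bound_on_ball n hd h0.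
have := Hp _ us 0 (fun x _ => H' x); have := ub 0; lra.
Qed.

(* Slide the compactly supported subsolution from infinity, where it lies
   below [u], to a point where [u <= z2]. *)
Lemma exists_close_to_m1 (b d L : R) u (i0 : 'I_n.+1) : i0 != ord_max ->
  0 < b <= 1 / 10 -> 0 < d < b ^+ 2 / 32 -> 0 < d < delta_max R ->
  entire_solution d u -> 0 < L ->
  (forall y e (t : R), dot e e = 1 -> `|u (y + t *: e) - u y| <= L * `|t|) ->
  (forall x, u x < z3 d) ->
  (forall h, 0 < h -> exists r : R, forall x, r <= transverse_sq x -> z3 d - h <= u x) ->
  exists x, u x <= - 1 + 2 * b.
Proof.
move=> i0N hb hdb hd us L0 lip ub far; apply: contrapT => H.
have big x : - 1 + 2 * b < u x by rewrite ltNge; apply/negP => ux; apply: H; exists x.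
have [uC _] := us; have [uc _ _] := uC.
have [p p0 [phi [phic phi0 phitop phibd phiL]]] := @compactly_supported_subsolution R n b d hb hdb.
have [x0 ux0] := exists_le_z2 hd us ub.
have [_ /andP[_ z2s] /andP[sz3 z31]] := roots_bounds hd.
have [_ _ f3] := roots_of_fdelta hd.
have /andP[s1 s2] := inv_sqrt3_bounds R.
have [/andP[b0 b1] /andP[d0 d1]] := (hb, hdb).
have top3 : 1 - b ^+ 2 / 2 < z3 d.
  rewrite ltNge; apply/negP => z3b; move: f3; rewrite /fdelta.
  by move: (z3 d) sz3 z31 z3b => t t1 t2 t3; nra.
pose e := basis_vec R i0.
have e1 : dot e e = 1 by rewrite dot_basis mxE !eqxx.
have e0 : e 0 ord_max = 0 by rewrite mxE eq_sym (negbTE i0N) andbF.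
pose y (t : R) := x0 + t *: e.
(* Positions at which the bump is not strictly below [u]. The set contains 0 and is bounded; at its
   supremum the Lipschitz bound forces exact contact, which the boundary values place in the
   interior of the ball. *)
pose J := [set t : R | 0 <= t /\ exists2 z, dot z z <= p & u (y t + z) <= phi z].
have J0 : J 0.
  split=> //; exists 0; first by rewrite dot0l ltW.
  by rewrite /y scale0r !addr0; apply: le_trans ux0 _; lra.
have yshift t t' z : `|u (y t + z) - u (y t' + z)| <= L * `|t - t'|.
  rewrite (_ : y t + z = y t' + z + (t - t') *: e); first exact: lip.
  by apply/rowP => j; rewrite /y !mxE; ring.
have Jsup : has_sup J.
  split; first by exists 0.
  have [|r Hr] := far (z3 d - (1 - b ^+ 2 / 2)); first by lra.
  exists (`|r| + 2 + p + `|dot x0 e|) => t [t0 [z zp uz]].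
  rewrite leNgt; apply/negP => tbig.
  have := phitop _ zp; rewrite ltNge => /negP; apply; apply: le_trans uz.
  have := Hr (y t + z); rewrite (_ : z3 d - _ = 1 - b ^+ 2 / 2); last by ring.
  apply.
  apply: le_trans (dot_sqr_le_transverse _ e1 e0).
  have ze : dot z e ^+ 2 <= p := le_trans (cauchy_schwarz_unit z e1) zp.
  rewrite /y !dotE e1 mulr1.
  have : - `|dot x0 e| <= dot x0 e by rewrite lerNl -normrN; exact: ler_norm.
  have := ler_norm r; have := normr_ge0 r.
  move: (dot z e) (dot x0 e) ze tbig => A B ze tbig r0 r1 B0.
  have A0 : - (1 + p) <= A by rewrite leNgt; apply/negP => ?; nra.
  have : `|r| + 1 <= B + t + A by lra.
  by move: (B + t + A) => C HC; nra.
pose t0 := sup J.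
have t00 : 0 <= t0 by exact: (sup_upper_bound Jsup) J0.
have [z zp zmin] : exists2 z, dot z z <= p & forall z', dot z' z' <= p ->
    u (y t0 + z) - phi z <= u (y t0 + z') - phi z'.
  have cont : continuous (fun z => u (y t0 + z) - phi z).
    move=> z'; have c1 : (fun z => y t0 + z) @ z' --> y t0 + z'.
      exact: (cvgD (cvg_cst (y t0)) (@cvg_id _ (nbhs z'))).
    exact: (cvgB (continuous_comp c1 (@uc _)) (phic z')).
  have [z zp zmin] := @sqball_min R n 0 p _ (ltW p0) (fun z' _ => cont z').
  rewrite subr0 in zp; exists z => // z' zp'.
  by apply: zmin; rewrite subr0.
pose mu := u (y t0 + z) - phi z.
have mu_le0 : mu <= 0.
  rewrite leNgt; apply/negP => mu0.
  have : 0 < mu / (2 * L) by rewrite divr_gt0 // mulr_gt0.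
  move=> /sup_adherent/(_ Jsup)[t Jt tt].
  have tle : t <= t0 by exact: (sup_upper_bound Jsup) Jt.
  have [_ [z' zp' uz']] := Jt.
  have := zmin _ zp'; rewrite -/mu => h1.
  have := yshift t0 t z'; rewrite [`|t0 - t|]ger0_norm ?subr_ge0 // => /ler_normlP[_ h2].
  have : L * (t0 - t) < mu / 2.
    have -> : mu / 2 = L * (mu / (2 * L)) by field; rewrite gt_eqF.
    by rewrite ltr_pM2l // -/t0 in tt *; lra.
  lra.
have mu_ge0 : 0 <= mu.
  rewrite leNgt; apply/negP => mu0.
  have m1 : 0 < - mu / L by rewrite divr_gt0 // oppr_gt0.
  have : J (t0 + - mu / L).
    split; first by lra.
    exists z => //; have := yshift (t0 + - mu / L) t0 z.
    rewrite (_ : t0 + - mu / L - t0 = - mu / L); last by ring.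
    rewrite [`|- mu / L|]gtr0_norm // (_ : L * (- mu / L) = - mu).
      by move=> /ler_normlP[_]; rewrite /mu; lra.
    by field; rewrite gt_eqF.
  by move=> /(sup_upper_bound Jsup); rewrite -/t0; lra.
have contact : u (y t0 + z) = phi z.
  by apply/eqP; rewrite -subr_eq0 eq_le mu_le0 mu_ge0.
have zp' : dot z z < p.
  rewrite lt_neqAle zp andbT; apply/eqP => /phibd.
  by rewrite -contact leNgt big.
have [M phiM lM] := phiL _ zp'.
have phiM' : has_laplacian (fun x => phi (x - y t0)) (y t0 + z) M.
  by apply: has_laplacian_shift; rewrite addrC addKr.
have := touching phiM' (has_laplacian_solution (y t0 + z) us).
have near_c : \forall x \near y t0 + z,
    u (y t0 + z) - phi (y t0 + z - y t0) <= u x - phi (x - y t0).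
  near=> x; rewrite (_ : y t0 + z - y t0 = z); last by rewrite addrC addKr.
  rewrite -{1}(subrK (y t0) x) [x - _ + _]addrC.
  apply: zmin; apply: ltW; near: x; apply: near_sqdist_lt.
  by rewrite (_ : y t0 + z - y t0 = z) // addrC addKr.
move=> /(_ near_c); rewrite contact; lra.
Unshelve. all: by end_near. Qed.

(** By contraposition: if [u - z1 >= eps] at [x], it is at least [eps / 2] on a ball whose size
    depends only on [L], and the barrier centred at [x] keeps it above [m] at [a]. *)
Lemma smallness_propagates (ro eps : R) : 0 < eps -> exists2 m : R, 0 < m &
  forall d u, 0 < d < delta_max R -> entire_solution d u ->
  forall a, u a - z1 d < m -> forall x, d2 x a <= ro -> u x - z1 d < eps.
Proof.
move=> eps0; have [L L0 HL] := @solution_lipschitz R n.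
pose r := (eps / (2 * L)) ^+ 2.
have r0 : 0 < r by rewrite exprn_gt0 // divr_gt0 // mulr_gt0.
have C0 : 0 <= 11 :> R by exact: ler0n.
have [k k0 Hk] := barrier_lower_bound n C0 r0.
(* The barrier vanishes at squared distance [ro + 1], hence is still positive at [ro]. *)
pose m := eps / 2 * (expR (- (k * ro)) - expR (- (k * (ro + 1)))).
exists m.
  rewrite mulr_gt0 ?divr_gt0 // subr_gt0 ltr_expR ltrN2 ltr_pM2l //; lra.
move=> d u hd us a am x xa; rewrite ltNge; apply/negP => xeps.
have [[uc _ _] _] := us; have lip := lipschitz_sqdist (HL d u hd us).
have [f1 _ _] := roots_of_fdelta hd; have [/andP[? ?] _ _] := roots_bounds hd.
have wc : continuous (fun z => u z - z1 d).
  by move=> z; exact: (cvgB (uc z) (cvg_cst (z1 d))).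
have := Hk (fun z => u z - z1 d) x (ro + 1) (eps / 2) wc _ _ _ a.
have -> : d2 a x = d2 x a by rewrite -[a - x]opprB dotNl dotNr opprK.
move=> K; suff : m <= u a - z1 d by rewrite leNgt am.
apply: le_trans (K _ _ _ _); last by lra.
- rewrite ler_wpM2l //; first by rewrite ltW // divr_gt0.
  by rewrite lerB // ler_expR lerN2 ler_wpM2l // ltW.
- by move=> z _; rewrite subr_ge0 solution_ge_z1.
- move=> z zx; have := lip z x.
  have : L * Num.sqrt (d2 z x) <= eps / 2.
    have -> : eps / 2 = L * (eps / (2 * L)) by field; rewrite gt_eqF.
    rewrite ler_pM2l // -[leRHS]ger0_norm; last by rewrite ltW // divr_gt0 // mulr_gt0.
    by rewrite -sqrtr_sqr ler_sqrt // -/r ltW.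
  by move=> h1 /ler_normlP[h2 _]; lra.
- move=> z _; exists (- fdelta d (u z)).
    exact/has_laplacian_subr/has_laplacian_solution.
  have z1n : `|z1 d| <= 2.
    by rewrite ler_norml; have := delta_max_lt R; case/andP: hd; lra.
  have := fdelta_lipschitz d (solution_abs_le2 hd us z) z1n.
  rewrite [`|u z - _|]ger0_norm ?subr_ge0 ?solution_ge_z1 //.
  by rewrite f1 subr0 => /ler_normlP[].
Qed.

End SmallParameter.

(** * Conclusion *)

Section Conclusion.
Variables (R : realType) (n : nat).
Local Notation E := 'rV[R]_n.+1.
Local Notation eN := (basis_vec R (@ord_max n)).
Implicit Types (x y a : E) (u : E -> R) (d : R).

Lemma radial_translate u a (i0 : 'I_n.+1) : i0 != ord_max ->
  (forall x y, transverse_sq x = transverse_sq y -> xlast x = xlast y ->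
    u (a + x) = u (a + y)) -> radial_x' (translate a u).
Proof.
move=> i0N H.
exists (fun r s => u (a + (r *: basis_vec R i0 + s *: eN))) => x.
rewrite /translate addrC; apply: H.
  rewrite transverse_sq_shift [RHS](bigD1 i0) //= [X in _ + X]big1 ?addr0.
    by rewrite !mxE !eqxx mulr1 sqr_sqrtr // transverse_sq_ge0.
  by move=> i /andP[_ ii0]; rewrite !mxE (negbTE ii0) andbF mulr0 expr0n.
by rewrite xlast_shift /xlast !mxE eq_sym (negbTE i0N) andbF mulr0 add0r.
Qed.

Lemma axis_attains_minimum u (a : E) (T : R) : continuous u -> 0 < T ->
  (forall x, u (x + T *: eN) = u x) ->
  (forall x, u (a + xlast x *: eN) <= u (a + x)) ->
  exists s, forall x, u (a + s *: eN) <= u x.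
Proof.
move=> uc T0 uT axis.
have cont : {within `[0, T], continuous (fun s => u (a + s *: eN))}.
  apply: continuous_subspaceT => s.
  have c1 : (fun s : R => a + s *: eN) @ s --> a + s *: eN.
    exact: (cvgD (cvg_cst a) (cvgZr_tmp (@cvg_id _ (nbhs s)))).
  exact: (continuous_comp c1 (@uc _)).
have [s _ smin] := EVT_min (ltW T0) cont.
exists s => x; have := axis (x - a); rewrite [a + (x - a)]addrC subrK.
apply: le_trans.
have [c [uc' /andP[c0 cT]]] := periodic_shift T0 uT (xlast (x - a) *: eN).
rewrite -(uc' (a + xlast _ *: _)) -addrA -scalerDl; apply: smin.
rewrite in_itv /=; move: c0 cT; rewrite xlast_shift /xlast !mxE !eqxx mulr1.
by move=> -> ->.
Qed.

(** Shifting the centre along the axis preserves radial symmetry, so one translation serves both the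
    symmetry and the limit. *)
Lemma radial_around_minimum d u (i0 : 'I_n.+1) : i0 != ord_max ->
  0 < d < delta_max R -> entire_solution d u ->
  ~ (exists c, forall x, u x = c) -> periodic_xlast u ->
  (exists2 r : R, 0 < r & forall x, ~ cylinder r x -> z2 d < u x) ->
  exists a, radial_x' (translate a u) /\ forall x, u a <= u x.
Proof.
move=> i0N hd us ncst [T T0 uT] ucyl.
have ub x : u x < z3 d by have /andP[] := solution_bounds hd us ncst x.
have far := far_field hd us ucyl.
have [L L0 HL] := @solution_lipschitz R n.
have lip := HL d u hd us.
have [a Ha axis] := axial_symmetry ub far (fun e e1 e0 =>
  reflection_symmetry hd us L0 lip ub T0 uT far e1 e0).
have [[uc _ _] _] := us.
have [s Hs] := axis_attains_minimum uc T0 uT axis.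
exists (a + s *: eN); split=> //; apply: radial_translate i0N _ => x y xy xyN.
rewrite -!addrA ![s *: _ + _]addrC; apply: Ha; first by rewrite !transverse_sq_shift.
by rewrite !xlast_shift xyN.
Qed.

Lemma dot_bounded_on_compact (K : set E) : compact K ->
  exists r : R, forall x, K x -> dot x x <= r.
Proof.
move=> cK; have [->|/set0P K0] := eqVneq K set0; first by exists 0.
have cont : {within K, continuous (fun x => dot (x - 0) (x - 0))}.
  by apply: continuous_subspaceT; exact: continuous_sqdist.
have [c _ cmax] := EVT_max_rV K0 cK cont.
by exists (dot (c - 0) (c - 0)) => x Kx; have := cmax x (mem_set Kx); rewrite subr0.
Qed.

End Conclusion.

Theorem theorem3 (R : realType) (n : nat) (hN : (2 <= n.+1)%N)
    (u : R -> 'rV[R]_n.+1 -> R)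
    (hnonconst : forall d : R, 0 < d < delta_max R ->
      ~ exists c : R, forall x, u d x = c)
    (hsol : forall d : R, 0 < d < delta_max R -> entire_solution d (u d))
    (hper : forall d : R, 0 < d < delta_max R -> periodic_xlast (u d))
    (hcyl : forall d : R, 0 < d < delta_max R ->
      exists2 r : R, 0 < r & forall x, ~ cylinder r x -> z2 d < u d x) :
  (forall d : R, 0 < d < delta_max R -> forall x, z1 d < u d x < z3 d) /\
  exists a : R -> 'rV[R]_n.+1,
    (forall d : R, 0 < d < delta_max R -> radial_x' (translate (a d) (u d))) /\
    (forall K : set 'rV[R]_n.+1, compact K ->
      {uniform K, (fun d => translate (a d) (u d)) @ 0^'+ --> cst (-1 : R)}).
Proof.
have bounds d : 0 < d < delta_max R -> forall x, z1 d < u d x < z3 d.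
  by move=> hd; apply: solution_bounds => //; [exact: hsol|exact: hnonconst].
split; first exact: bounds.
have [i0 i0N] : exists i0 : 'I_n.+1, i0 != ord_max.
  by exists ord0; rewrite -val_eqE /= eq_sym -lt0n.
have /choice[a Ha] d : exists a, 0 < d < delta_max R ->
    radial_x' (translate a (u d)) /\ forall x, u d a <= u d x.
  have [hd|hd] := boolP (0 < d < delta_max R); last by exists 0.
  have [a Ha] := radial_around_minimum i0N hd (hsol d hd) (hnonconst d hd)
    (hper d hd) (hcyl d hd).
  by exists a.
exists a; split=> [d /Ha[]//|K cK].
have [L L0 HL] := @solution_lipschitz R n.
have [ro Kro] := dot_bounded_on_compact cK.
move=> P /uniform_nbhs[V [entV VP]].
move: entV; rewrite -entourage_ballE => -[eps /= eps0 epsV].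
have eps2 : 0 < eps / 2 by rewrite divr_gt0.
have [m m0 Hm] := smallness_propagates n ro eps2.
(* The minimum is then at most [- 1 + m / 2], and [z1 > - 1 - d > - 1 - m / 2], so [u - z1 < m]
   there. *)
pose b := Num.min (1 / 10) (m / 4).
have b0 : 0 < b by rewrite lt_min; apply/andP; split; lra.
have b1 : b <= 1 / 10 by rewrite ge_min lexx.
have b2 : b <= m / 4 by rewrite ge_min lexx orbT.
have B0 : 0 < b ^+ 2 / 32 by rewrite divr_gt0 ?exprn_gt0.
have dm0 : 0 < delta_max R.
  by rewrite /delta_max divr_gt0 // mulr_gt0 // sqrtr_gt0.
rewrite /= /nbhs /=; near=> d.
have d0 : 0 < d by near: d; exact: nbhs_right_gt.
have dB : d < b ^+ 2 / 32 by near: d; exact: nbhs_right_lt.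
have dm : d < m / 2 by near: d; apply: nbhs_right_lt; rewrite divr_gt0.
have de : d < eps by near: d; exact: nbhs_right_lt.
have hd : 0 < d < delta_max R.
  by rewrite d0; near: d; exact: nbhs_right_lt.
apply: VP => x Kx; apply: epsV => /=.
have [_ amin] := Ha d hd; have us := hsol d hd.
have [/andP[h1 h2] _ _] := roots_bounds hd.
have [x0 ux0] : exists x, u d x <= - 1 + 2 * b.
  apply: (exists_close_to_m1 i0N _ _ hd us L0 (HL d (u d) hd us)).
  - by rewrite b0.
  - by rewrite d0.
  - by move=> y; have /andP[] := bounds d hd y.
  - exact: far_field hd us (hcyl d hd).
have small : u d (a d) - z1 d < m.
  by have := amin x0; lra.
have := Hm d (u d) hd us (a d) small (x + a d).
rewrite addrK => /(_ (Kro x Kx)) xs.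
have /andP[xl _] := bounds d hd (x + a d).
rewrite /ball /= /translate /cst distrC ltr_norml; apply/andP; split; lra.
Unshelve. all: by end_near. Qed.
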